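(* Let $(S_1,S_2,P)$ be a $\Gamma_3$-contraction on a Hilbert space $\mathcal H$. Let $\mathcal H_1$ be the maximal subspace of $\mathcal H$ which reduces $P$ and on which $P$ is unitary, and let $\mathcal H_2=\mathcal H\ominus\mathcal H_1$. Then $\mathcal H_1$ and $\mathcal H_2$ reduce $S_1$ and $S_2$; the triple $(S_1|_{\mathcal H_1},S_2|_{\mathcal H_1},P|_{\mathcal H_1})$ is a $\Gamma_3$-unitary; and the triple $(S_1|_{\mathcal H_2},S_2|_{\mathcal H_2},P|_{\mathcal H_2})$ is a completely non-unitary $\Gamma_3$-contraction. (Either of the subspaces $\mathcal H_1$, $\mathcal H_2$ may equal the trivial subspace $\{0\}$.)
   Context: All operators are bounded linear operators on complex Hilbert spaces. The closed symmetrized tridisc is $$\Gamma_3=\{(z_1+z_2+z_3,\ z_1z_2+z_2z_3+z_3z_1,\ z_1z_2z_3): z_i\in\mathbb C,\ |z_i|\le 1,\ i=1,2,3\}\subseteq\mathbb C^3,$$ and its distinguished boundary is $$b\Gamma_3=\{(z_1+z_2+z_3,\ z_1z_2+z_2z_3+z_3z_1,\ z_1z_2z_3): z_i\in\mathbb C,\ |z_i|=1,\ i=1,2,3\}.$$ A compact set $X\subseteq\mathbb C^n$ is a spectral set for a commuting $n$-tuple $\underline T=(T_1,\dots,T_n)$ of bounded operators on a Hilbert space if the Taylor joint spectrum $\sigma_T(\underline T)$ is contained in $X$ and $\|f(\underline T)\|\le \|f\|_{\infty,X}=\sup\{|f(z)|: z\in X\}$ for all $f\in\mathcal R(X)$,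 where $\mathcal R(X)$ is the algebra of quotients $p/q$ of holomorphic polynomials in $n$ variables such that $q$ has no zeros in $X$. A triple of commuting operators $(S_1,S_2,P)$ on a Hilbert space is a $\Gamma_3$-contraction if $\Gamma_3$ is a spectral set for it (in this case $P$ is a contraction, i.e. $\|P\|\le 1$). A contraction is completely non-unitary if there is no nonzero closed reducing subspace on which it acts as a unitary. A $\Gamma_3$-contraction $(S_1,S_2,P)$ is completely non-unitary if $P$ is a completely non-unitary contraction. A commuting triple $(S_1,S_2,P)$ is a $\Gamma_3$-unitary if $S_1,S_2,P$ are normal operators and the Taylor joint spectrum $\sigma_T(S_1,S_2,P)$ is contained in $b\Gamma_3$. A subspace reduces an operator if it is closed and invariant under both the operator and its adjoint. On the trivial space $\{0\}$ the corresponding assertions are regarded as vacuous. *)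

(* Defs.v *)
From HB Require Import structures.
From mathcomp Require Import all_boot all_order all_algebra.
From mathcomp Require Import all_classical all_reals all_analysis.
From mathcomp Require Import ring complex.
From mathcomp Require mpoly.

Set Implicit Arguments.
Unset Strict Implicit.
Unset Printing Implicit Defensive.

Import Order.TTheory GRing.Theory Num.Theory.
Import numFieldNormedType.Exports.

Local Open Scope classical_set_scope.
Local Open Scope ring_scope.

HB.instance Definition _ (R : realType) := NormedModule.copy R[i] (R[i]^o).

(* The trivial space {0} is allowed. *)
HB.mixin Record isHilbert (R : realType) H & CompleteNormedModule R[i] H := {
  inner : {dot H for (@Num.conj R[i])};
  inner_norm : forall x : H, `|x| ^+ 2 = inner x x }.

#[short(type="hilbertType")]
HB.structure Definition Hilbert (R : realType) :=
  {H of CompleteNormedModule R[i] H & isHilbert R H}.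

(* The norm of a normed module over R[i] lives in R[i]; its suprema are taken
   in R. *)
Definition rnorm (R : realType) (V : normedModType R[i]) (x : V) : R :=
  complex.Re `|x|.

Record boundedOp (R : realType) (H : hilbertType R) := BoundedOp {
  boundedOp_fun :> {linear H -> H};
  boundedOpP : exists M : R[i], forall x, `|boundedOp_fun x| <= M * `|x| }.

Definition opnorm (R : realType) (H : hilbertType R) (T : H -> H) : R :=
  sup [set rnorm (T x) | x in [set x | `|x| <= 1]].

(* For bounded T, the chosen vector exists by the Riesz representation theorem
   and is unique. *)
Definition adjoint (R : realType) (H : hilbertType R) (T : H -> H) (y : H) : H :=
  get [set z | forall x, inner (T x) y = inner x z].

Definition contraction_op (R : realType) (H : hilbertType R) (T : H -> H) :=
  opnorm T <= 1.

Definition normal_op (R : realType) (H : hilbertType R) (T : H -> H) :=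
  forall x, T (adjoint T x) = adjoint T (T x).

Definition unitary_op (R : realType) (H : hilbertType R) (T : H -> H) :=
  (forall x, adjoint T (T x) = x) /\ (forall x, T (adjoint T x) = x).

Record closedSubspace (R : realType) (H : hilbertType R) := ClosedSubspace {
  subspace_set :> H -> Prop;
  subspace0 : subspace_set 0;
  subspaceD : forall x y, subspace_set x -> subspace_set y -> subspace_set (x + y);
  subspaceZ : forall (a : R[i]) x, subspace_set x -> subspace_set (a *: x);
  subspace_closed : closed (subspace_set : set H) }.

Section SubHilbert.
Context (R : realType) (H : hilbertType R) (M : closedSubspace H).

Definition subHilbert : Type := {x : H | x \in (M : set H)}.

HB.instance Definition _ := [isSub of subHilbert for @sval _ _].
HB.instance Definition _ := [Choice of subHilbert by <:].

Lemma subHilbertP (x : subHilbert) : M (val x).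
Proof. exact: set_mem (valP x). Qed.

Fact subHilbert_closed : subsemimod_closed (fun x : H => x \in (M : set H)).
Proof.
split; first split.
- exact/mem_set/subspace0.
- by move=> x y /set_mem Mx /set_mem My; exact/mem_set/subspaceD.
- by move=> a x /set_mem Mx; exact/mem_set/subspaceZ.
Qed.

HB.instance Definition _ :=
  GRing.SubChoice_isSubLmodule.Build R[i] H _ subHilbert subHilbert_closed.

Fact subHilbert_normD (x y : subHilbert) :
  `|val (x + y)| <= `|val x| + `|val y|.
Proof. by rewrite raddfD ler_normD. Qed.

Fact subHilbert_normZ (a : R[i]) (x : subHilbert) :
  `|val (a *: x)| = `|a| * `|val x|.
Proof. by rewrite linearZ normrZ. Qed.

Fact subHilbert_norm0 (x : subHilbert) : `|val x| = 0 -> x = 0.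
Proof. by move/normr0_eq0 => x0; apply/val_inj; rewrite raddf0. Qed.

HB.instance Definition _ := Lmodule_isNormed.Build R[i] subHilbert
  subHilbert_normD subHilbert_normZ subHilbert_norm0.

Fact subHilbert_complete (F : set_system subHilbert) :
  ProperFilter F -> cauchy F -> cvg F.
Proof.
move=> FF /cauchyP Fc.
have vE (x y : subHilbert) (e : R[i]) : ball x e y = ball (val x) e (val y).
  have n : `|x - y| = `|val x - val y| by rewrite -raddfB.
  by rewrite -!ball_normE /ball_/= n.
have Gc : cauchy (val @ F).
  apply/cauchyP => e e0; have [x Fx] := Fc e e0; exists (val x).
  have : F [set y | ball (val x) e (val y)].
    by apply: filterS Fx => y; rewrite vE.
  by [].
have /cvg_ex[l Fl] : cvg (val @ F) by exact: cauchy_cvg.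
have Ml : M l.
  apply: (closed_cvg _ (@subspace_closed _ _ M) _ _ Fl).
  by apply: nearW => x; exact: subHilbertP.
apply/cvg_ex; exists (exist _ l (mem_set Ml) : subHilbert).
apply/cvg_ballP => e e0; have /cvg_ballP/(_ e e0) Fe := Fl.
have {}Fe : F [set y | ball l e (val y)] by [].
by apply: filterS Fe => y; rewrite vE.
Qed.

HB.instance Definition _ :=
  Uniform_isComplete.Build subHilbert subHilbert_complete.

Definition subInner (x y : subHilbert) : R[i] := inner (val x) (val y).

Fact subInner_linear :
  bilinear_for *%R (Num.conj \; *%R) subInner.
Proof.
by split => z a x y; rewrite /subInner linearP/= ?linearPl ?linearPr.
Qed.

HB.instance Definition _ := bilinear_isBilinear.Build R[i] subHilbert subHilbert
  R[i] *%R (Num.conj \; *%R) subInner subInner_linear.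

Fact subInner_herm (x y : subHilbert) :
  subInner x y = (-1) ^+ false * Num.conj (subInner y x).
Proof. exact: hermitian_subproof. Qed.

HB.instance Definition _ := isHermitianSesquilinear.Build R[i] subHilbert false
  (@Num.conj R[i]) subInner subInner_herm.

Fact subInner_gt0 (x : subHilbert) : x != 0 -> 0 < subInner x x.
Proof.
move=> x0; apply: neq0_dnorm_gt0; apply: contra x0 => /eqP x0.
by apply/eqP/val_inj; rewrite x0 raddf0.
Qed.

HB.instance Definition _ :=
  isDotProduct.Build R[i] subHilbert subInner subInner_gt0.

Fact subInner_norm (x : subHilbert) : `|x| ^+ 2 = subInner x x.
Proof. exact: inner_norm. Qed.

HB.instance Definition _ := isHilbert.Build R subHilbert subInner_norm.

End SubHilbert.

Section InnerTheory.
Context (R : realType) (H : hilbertType R).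
Implicit Types x y : H.

Lemma inner_le x y : `|inner x y| <= `|x| * `|y|.
Proof.
have [->|y0] := eqVneq y 0; first by rewrite linear0r !normr0 mulr0.
have yy : 0 < inner y y by exact: neq0_dnorm_gt0.
have yR : Num.conj (inner y y) = inner y y by exact/conj_Creal/gtr0_real.
suff : `|inner x y| ^+ 2 <= inner x x * inner y y.
  by rewrite -!inner_norm -exprMn ler_sqr ?nnegrE ?mulr_ge0.
have := dnorm_ge0 (@inner R H) (x - (inner x y / inner y y) *: y).
rewrite dnormB dnormZ linearZr_LR/= normCK !rmorphM/= conjCK !fmorphV/= !yR.
have /lt0r_neq0 := yy; move: yy yR.
move: (inner x y) (inner y y) (inner x x) => a d b yy _ d0.
have -> : b + a / d * (Num.conj a / d) * d -
    (Num.conj a / d * a + a * d^-1 * Num.conj a) = b - a * Num.conj a / d.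
  by field.
by rewrite subr_ge0 normCK ler_pdivrMr.
Qed.

Lemma inner_continuousl y : continuous (fun x => inner x y).
Proof.
move=> x; apply/cvgrPdist_lt => e e0; near=> z.
rewrite -linearBl/=; apply: le_lt_trans (inner_le _ _) _.
apply: (@le_lt_trans _ _ (`|x - z| * (`|y| + 1))).
  by rewrite ler_wpM2l ?lerDl.
rewrite -ltr_pdivlMr ?ltr_wpDl//; near: z.
by apply: cvgr_dist_lt => //; rewrite divr_gt0 ?ltr_wpDl.
Unshelve. all: by end_near. Qed.

End InnerTheory.

Section Reduction.
Context (R : realType) (H : hilbertType R).
Implicit Types (T : boundedOp H) (M : closedSubspace H).

Definition reduces T M :=
  (forall x, M x -> M (T x)) /\ (forall x, M x -> M (adjoint T x)).

Section Restriction.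
Variables (T : boundedOp H) (M : closedSubspace H) (TM : reduces T M).

Definition restr_fun (x : subHilbert M) : subHilbert M :=
  exist _ (T (val x)) (mem_set (TM.1 _ (subHilbertP x))).

Fact restr_linear : linear restr_fun.
Proof. by move=> a x y; apply/val_inj; rewrite /= !linearP. Qed.

HB.instance Definition _ := GRing.isLinear.Build R[i] _ _ _ restr_fun restr_linear.

Fact restr_bounded : exists B : R[i], forall x, `|restr_fun x| <= B * `|x|.
Proof. by have [B TB] := boundedOpP T; exists B => x; exact: TB. Qed.

Definition restr : boundedOp (subHilbert M) := BoundedOp restr_bounded.

End Restriction.

Section Orthocomplement.
Variable M : closedSubspace H.

Let perp : set H := [set x | forall y, M y -> inner x y = 0].

Fact perp0 : perp 0.
Proof. by move=> y _; rewrite linear0l. Qed.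

Fact perpD x y : perp x -> perp y -> perp (x + y).
Proof. by move=> px py z Mz; rewrite linearDl/= px// py// addr0. Qed.

Fact perpZ (a : R[i]) x : perp x -> perp (a *: x).
Proof. by move=> px z Mz; rewrite linearZl_LR/= px// mulr0. Qed.

Fact perp_closed : closed perp.
Proof.
have -> : perp = \bigcap_(y in (M : set H)) [set x | inner x y = 0].
  by apply/seteqP; split => x.
apply: closed_bigI => y _.
apply: (@preimage_closed _ R[i] (fun x => inner x y) [set 0]).
  by move=> x _; exact: inner_continuousl.
exact/accessible_closed_set1/hausdorff_accessible/norm_hausdorff.
Qed.

Definition orthocomplement : closedSubspace H :=
  ClosedSubspace perp0 perpD perpZ perp_closed.

End Orthocomplement.
End Reduction.

Section JointSpectrum.
Context (R : realType) (H : hilbertType R) (n : nat).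
Implicit Types T : 'I_n -> boundedOp H.

Definition commuting T := forall i j x, T i (T j x) = T j (T i x).

(* H tensor the exterior algebra on e_0, ..., e_(n-1) is represented by the
   coordinate functions f : {set 'I_n} -> H, standing for the sum over A of
   f A (x) e_A, where e_A is the wedge of the e_i, i in A, in increasing order.
   The Koszul differential D_T = sum_i T_i (x) (e_i /\ _) has the coefficients
   below, since e_i /\ e_(A minus i) = (-1)^#{j in A | j < i} e_A. *)
Definition koszul (T : 'I_n -> H -> H) (f : {set 'I_n} -> H)
    (A : {set 'I_n}) : H :=
  \sum_(i in A) (-1) ^+ #|[set j in A | (j < i)%N]%SET| *: T i (f (A :\ i)%SET).

(* Exactness of the graded Koszul complex in every degree amounts to
   Ker D_T = Ran D_T on the whole exterior algebra, D_T being homogeneous. *)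
Definition koszul_exact (T : 'I_n -> H -> H) :=
  forall f, koszul T f =1 (fun=> 0) -> exists g, koszul T g =1 f.

Definition taylor_spectrum T : set 'rV[R[i]]_n :=
  [set l | ~ koszul_exact (fun i x => T i x - l ord0 i *: x)].

(* The order of composition is immaterial when T commutes. *)
Definition monomial_op T (m : 'I_n -> nat) : H -> H :=
  \big[(fun f g : H -> H => f \o g)/id]_(i < n) iter (m i) (T i).

Definition poly_op T (p : mpoly.mpoly n R[i]) (x : H) : H :=
  \sum_(m <- mpoly.msupp p)
    mpoly.mcoeff m p *: monomial_op T (mpoly.fun_of_multinom m) x.

Definition peval (p : mpoly.mpoly n R[i]) (z : 'rV[R[i]]_n) : R[i] :=
  mpoly.meval (fun i => z ord0 i) p.

(* (p / q)(T) is p(T) Q with Q the inverse of q(T). *)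
Definition spectral_set (X : set 'rV[R[i]]_n) T :=
  [/\ compact X, commuting T, taylor_spectrum T `<=` X &
    forall p q, (forall z, X z -> peval q z != 0) ->
      exists Q : boundedOp H,
        [/\ cancel Q (poly_op T q), cancel (poly_op T q) Q &
            opnorm (poly_op T p \o Q) <=
              sup [set rnorm (peval p z / peval q z) | z in X]]].

End JointSpectrum.

Section Tridisc.
Context (R : realType).

Definition symm3 (z1 z2 z3 : R[i]) : 'rV[R[i]]_3 :=
  \row_i tnth [tuple z1 + z2 + z3; z1 * z2 + z2 * z3 + z3 * z1; z1 * z2 * z3] i.

Definition Gamma3 : set 'rV[R[i]]_3 :=
  [set s | exists z1 z2 z3,
    [/\ `|z1| <= 1, `|z2| <= 1, `|z3| <= 1 & s = symm3 z1 z2 z3]].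

Definition bGamma3 : set 'rV[R[i]]_3 :=
  [set s | exists z1 z2 z3,
    [/\ `|z1| = 1, `|z2| = 1, `|z3| = 1 & s = symm3 z1 z2 z3]].

End Tridisc.

Section Gamma3Operators.
Context (R : realType) (H : hilbertType R).
Implicit Types (P : boundedOp H) (M N : closedSubspace H).

Definition triple (S1 S2 P : boundedOp H) (i : 'I_3) : boundedOp H :=
  tnth [tuple S1; S2; P] i.

Definition Gamma3_contraction (S1 S2 P : boundedOp H) :=
  spectral_set (@Gamma3 R) (triple S1 S2 P).

Definition Gamma3_unitary (S1 S2 P : boundedOp H) :=
  [/\ commuting (triple S1 S2 P), normal_op S1, normal_op S2, normal_op P &
      taylor_spectrum (triple S1 S2 P) `<=` @bGamma3 R].

Definition unitary_on P M := exists PM : reduces P M, unitary_op (restr PM).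

Definition cnu_contraction P :=
  contraction_op P /\ forall M, unitary_on P M -> forall x, M x -> x = 0.

Definition cnu_Gamma3_contraction (S1 S2 P : boundedOp H) :=
  Gamma3_contraction S1 S2 P /\ cnu_contraction P.

Definition maximal_unitary_subspace P M :=
  unitary_on P M /\ forall N, unitary_on P N -> forall x, N x -> M x.

End Gamma3Operators.

(* Main.v *)
From HB Require Import structures.
Require Import Defs.
From mathcomp Require Import all_boot all_order all_algebra.
From mathcomp Require Import all_classical all_reals all_analysis.
From mathcomp Require Import ring lra complex.
From mathcomp Require Import -(notations) mpoly.

Set Implicit Arguments.
Unset Strict Implicit.
Unset Printing Implicit Defensive.

Import Order.TTheory GRing.Theory Num.Theory.
Import numFieldNormedType.Exports.

Local Open Scope classical_set_scope.
Local Open Scope ring_scope.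
Local Open Scope complex_scope.
Local Notation re := complex.Re.

(** Write [P*] for the adjoint of [P], and let [U] be the set of the vectors [x]
    such that [P* P] fixes every [P^n x] and [P P*] fixes every [P*^n x]. It is
    a closed subspace that reduces [P] to a unitary operator, and it contains
    every set of vectors that is invariant under [P] and [P*] and on which
    [P* P] and [P P*] are the identity. Hence [U] is the largest subspace that reduces
    [P] to a unitary operator ([unitary_part_maximal]).

    The operators [S1] and [S2] enter through two scalar inequalities on the
    closed symmetrized tridisc, [|3 p - s2| <= |3 - s1|] and
    [|3 p - s1| <= |3 - s2|] ([symm3_pencil1], [symm3_pencil2]), which are
    equalities on the distinguished boundary, where [s2] is the conjugate of
    [s1] times [p]. Since the tridisc is a spectral set, they pass to the
    operators, with [(s1, s2, p)] rotated by any unimodular number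
    ([Gamma3_contraction_pencils]). Combining rotations so that the norms of
    [S1 y] and [S2 y] cancel leaves, for all unimodular [w],
      [Re (w <(S1 - S2* P) y, y>) <= 3 (|y|^2 - |P y|^2)]
    and the same with [S1] and [S2] exchanged ([fundamental_form]). The right
    side does not change when a vector [t x] with [x] in [U] is added to [y],
    so the terms linear in [t] on the left must vanish. This yields, on [U],
      [S1 = S2* P], [S1* = P* S2], [S2 = S1* P], [S2* = P* S1]
    ([fundamental_equations]). These four identities and the commutation of
    the triple give [P* P S1 x = P* S1 P x = S2* P x = S1 x] and
    [P* S1 x = S1 P* x] for [x] in [U], whence [S1] maps [U] to itself; so do
    [S2] and, by the identities again, the adjoints. They also make the
    restrictions of [S1] and [S2] to [U] normal.

    A subspace that reduces the triple inherits the spectral set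
    ([spectral_set_restr]): the Koszul complex of the restriction is a direct
    summand, and the inverses of polynomials in the triple restrict. On [U] a
    point [(s1, s2, p)] of the joint spectrum lies in the tridisc and satisfies
    [|p| >= 1], as otherwise [P - p] would be invertible and the Koszul complex
    exact ([koszul_exact_of_invertible]); hence it lies on the distinguished
    boundary. On the orthogonal complement of [U] the operator [P] is
    completely non-unitary by the maximality of [U].

    All adjoints and projections rest on the projection theorem
    ([orthogonal_projection]) and on the representation of functionals
    ([riesz]), proved from completeness. *)

(** * Completeness and orthogonal projection *)

Section HilbertGeometry.
Context (R : realType).

Lemma normE (V : normedModType R[i]) (x : V) : `|x| = (rnorm x)%:C.
Proof. by rewrite RRe_real// ger0_real. Qed.

Lemma rnorm_ge0 (V : normedModType R[i]) (x : V) : 0 <= rnorm x.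
Proof. by rewrite -ler0c -normE. Qed.

Lemma le_cvg0_eq0 (r : R) (e : nat -> R) :
  0 <= r -> (forall n, r <= e n) -> e @ \oo --> 0 -> r = 0.
Proof.
move=> r0 re e0; apply/eqP; rewrite eq_le r0 andbT.
by apply: ler_cvg_to (cvg_cst r) e0 _; exact: nearW.
Qed.

(** Norms take their values in [R[i]], while the usual real sequences that
    tend to 0 live in [R]; this is completeness in the form used below. *)
Lemma complete_cvg (V : completeNormedModType R[i]) (u : nat -> V)
    (e : nat -> R) :
    (forall n m, (n <= m)%N -> rnorm (u n - u m) <= e n) ->
    e @ \oo --> 0 ->
  exists2 l, u @ \oo --> l & forall n, rnorm (u n - l) <= e n.
Proof.
move=> ue e0.
have Cu : cauchy (u @ \oo).
  apply/cauchyP => d d0.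
  have dE : d = (re d)%:C by rewrite RRe_real// gtr0_real.
  have : \forall n \near \oo, `|0 - e n| < re d.
    by apply: cvgr_dist_lt => //; rewrite -ltcR -dE.
  move=> [n _ /(_ n (leqnn _))].
  rewrite /= sub0r normrN => en; exists (u n); exists n => // m /= nm.
  rewrite -ball_normE /ball_/= normE dE ltcR.
  by apply: le_lt_trans (ue _ _ nm) _; apply: le_lt_trans (ler_norm _) en.
have /cvg_ex[l ul] : cvg (u @ \oo) by exact: cauchy_cvg.
exists l => // n; rewrite leNgt; apply/negP => nl.
pose d : R := rnorm (u n - l) - e n.
have d0 : 0 < d by rewrite subr_gt0.
have : \forall m \near \oo, `|l - u m| < d%:C.
  by apply: cvgr_dist_lt => //; rewrite ltcR.
move=> [m _ /(_ (maxn n m) (leq_maxr _ _))] /=.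
apply/negP; rewrite -real_leNgt ?ger0_real//; last first.
  by rewrite ler0c ltW.
have := ler_distD (u (maxn n m)) (u n) l.
rewrite [`|u (maxn _ _) - l|]distrC !normE -rmorphD !lecR => h.
rewrite /d lerBlDr; apply: le_trans h _; rewrite addrC lerD2l.
by apply: ue; rewrite leq_maxl.
Qed.

Variable (H : hilbertType R).
Implicit Types (x y z : H) (M : closedSubspace H).

Lemma innerC x y : inner x y = Num.conj (inner y x).
Proof. by rewrite hermC expr0 mul1r. Qed.

Lemma inner_eq0_sym x y : inner x y = 0 -> inner y x = 0.
Proof. by rewrite innerC => /eqP; rewrite fmorph_eq0 => /eqP. Qed.

Lemma inner_eq x y : (forall z, inner z x = inner z y) -> x = y.
Proof.
move=> xy; apply/eqP; rewrite -subr_eq0 -(@dnorm_eq0 _ _ (@inner R H)).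
by rewrite linearBr/= xy subrr.
Qed.

Lemma subspaceB M x y : M x -> M y -> M (x - y).
Proof. by move=> Mx My; rewrite -scaleN1r; apply/subspaceD/subspaceZ. Qed.

Lemma dist2E x y : (rnorm (x - y) ^+ 2)%:C = inner (x - y) (x - y).
Proof. by rewrite rmorphXn/= -normE inner_norm. Qed.

Lemma rnormZ (a : R) x : 0 <= a -> rnorm (a%:C *: x) = a * rnorm x.
Proof.
by move=> a0; apply: complexI; rewrite rmorphM/= -!normE normrZ ger0_norm ?ler0c.
Qed.

Lemma rnormZc (a : R[i]) x : rnorm (a *: x) = re `|a| * rnorm x.
Proof.
by apply: complexI; rewrite rmorphM/= RRe_real ?ger0_real// -!normE normrZ.
Qed.

Lemma rnormD x y : rnorm (x + y) <= rnorm x + rnorm y.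
Proof. by rewrite -lecR rmorphD/= -!normE ler_normD. Qed.

Lemma rnormN x : rnorm (- x) = rnorm x.
Proof. by rewrite /rnorm normrN. Qed.

Lemma rnormB x y : rnorm (x - y) <= rnorm x + rnorm y.
Proof. by rewrite -(rnormN y); exact: rnormD. Qed.

Lemma parallelogram x y :
  rnorm (x + y) ^+ 2 + rnorm (x - y) ^+ 2 =
  2 * rnorm x ^+ 2 + 2 * rnorm y ^+ 2.
Proof.
apply: complexI; rewrite !expr2 !(rmorphD, rmorphM) /= -!normE -!expr2 !inner_norm.
by rewrite dnormD dnormB; ring.
Qed.

(** The distance minimizing sequence is Cauchy by the parallelogram law, and the
    inner products of its error with a vector [z] of the subspace tend to 0:
    moving along [z] could otherwise decrease the distance. The excess over the
    infimum is the square of a harmonic term, so that distances between members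
    of the sequence are bounded by harmonic terms. *)
Theorem orthogonal_projection M x :
  exists2 m, M m & forall z, M z -> inner (x - m) z = 0.
Proof.
pose D := [set rnorm (x - m) ^+ 2 | m in (M : set H)].
pose d := inf D.
have D0 : D !=set0 by exists (rnorm (x - 0) ^+ 2); exists 0 => //; exact: subspace0.
have Dlb : has_lbound D by exists 0 => _ [m _ <-]; exact: sqr_ge0.
have dP m : M m -> d <= rnorm (x - m) ^+ 2 by move=> Mm; apply: ge_inf => //; exists m.
have /choice[u uP] : forall n : nat, exists m,
    M m /\ rnorm (x - m) ^+ 2 < d + harmonic n ^+ 2.
  move=> n; have h0 : 0 < (harmonic n : R) ^+ 2.
    by rewrite exprn_gt0// harmonic_gt0.
  by have [_ [m Mm <-] h] := inf_adherent h0 (conj D0 Dlb); exists m.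
have uM n : M (u n) by case: (uP n).
have ud n : rnorm (x - u n) ^+ 2 < d + harmonic n ^+ 2 by case: (uP n).
have [l ul le] : exists2 l, u @ \oo --> l &
    forall n, rnorm (u n - l) <= 2 * harmonic n.
  apply: complete_cvg.
    move=> n k nk.
    have hkn : (harmonic k : R) <= harmonic n.
      by rewrite /harmonic/= lef_pV2 ?posrE// ler_nat.
    have h0 p : 0 <= (harmonic p : R) by exact: harmonic_ge0.
    rewrite -ler_sqr ?nnegrE ?rnorm_ge0 ?mulr_ge0//.
    (* The midpoint of [u k] and [u n] is at distance at least [sqrt d]. *)
    have := parallelogram (x - u k) (x - u n).
    have -> : x - u k - (x - u n) = u n - u k by rewrite opprB addrC addrA subrK.
    have -> : x - u k + (x - u n) = 2%:R%:C *: (x - 2^-1 *: (u k + u n)).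
      rewrite rmorph_nat scalerBr scalerA divff// scale1r scaler_nat mulr2n opprD.
      by rewrite addrACA.
    rewrite rnormZ// exprMn.
    have := dP _ (subspaceZ 2^-1 (subspaceD (uM k) (uM n))).
    have := ud n; have := ud k.
    have : (harmonic k : R) ^+ 2 <= harmonic n ^+ 2 by rewrite ler_sqr ?nnegrE.
    rewrite exprMn; lra.
  rewrite -[X in _ --> X](mulr0 2); apply: cvgMr; exact: cvg_harmonic.
have Ml : M l.
  apply: (closed_cvg _ (@subspace_closed _ _ M) _ _ ul).
  exact: nearW.
exists l => // z Mz.
have [->|z0] := eqVneq z 0; first by rewrite linear0r.
have err n : `|inner (x - u n) z| <= (harmonic n * rnorm z)%:C.
  set v := x - u n.
  have zz : 0 < inner z z by exact: neq0_dnorm_gt0.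
  rewrite -ler_sqr ?nnegrE//; last first.
    by rewrite ler0c mulr_ge0 ?harmonic_ge0 ?rnorm_ge0.
  have -> : (harmonic n * rnorm z)%:C ^+ 2 = (harmonic n ^+ 2)%:C * inner z z.
    by rewrite -inner_norm normE !expr2 !rmorphM/=; ring.
  have hu : inner v v <= d%:C + (harmonic n ^+ 2)%:C.
    by rewrite -rmorphD/= -dist2E lecR ltW.
  (* The coefficient is the one that minimizes the distance along [z]. *)
  have hd : d%:C <= inner (v - (inner v z / inner z z) *: z)
                          (v - (inner v z / inner z z) *: z).
    rewrite -dist2E lecR /v -addrA -opprD.
    exact: dP (subspaceD (uM n) (subspaceZ _ Mz)).
  have zR : Num.conj (inner z z) = inner z z by exact/conj_Creal/gtr0_real.
  clearbody v; move: hu hd; rewrite dnormB dnormZ linearZr_LR/= !normCK !rmorphM/= conjCK.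
  rewrite !fmorphV/= !zR.
  move: zz; move: (inner z z) (inner v z) (inner v v) => b a c b0.
  have bN : b != 0 by rewrite gt_eqF.
  have -> : c + a / b * (Num.conj a / b) * b -
      (Num.conj a / b * a + a * b^-1 * Num.conj a) = c - a * Num.conj a / b.
    by field.
  move=> hu hd; rewrite -ler_pdivrMr// -(lerD2l d%:C); apply: le_trans hu.
  by rewrite -lerBrDr.
have : re `|inner (x - l) z| = 0.
  apply: (@le_cvg0_eq0 _ (fun n => 3 * rnorm z * harmonic n)); last 2 first.
  - move=> n; rewrite -lecR RRe_real ?ger0_real//.
    rewrite -(subrK (u n) x) -addrA linearDl/=.
    apply: le_trans (ler_normD _ _) _.
    apply: le_trans (lerD (err n) (inner_le _ _)) _.
    rewrite !normE -rmorphM -rmorphD lecR.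
    have -> : 3 * rnorm z * harmonic n = harmonic n * rnorm z + 2 * harmonic n * rnorm z.
      by ring.
    by rewrite lerD2l ler_wpM2r ?rnorm_ge0.
  - rewrite -[X in _ --> X](mulr0 (3 * rnorm z)); apply: cvgMr; exact: cvg_harmonic.
  by rewrite -ler0c RRe_real// ger0_real.
move/(congr1 (real_complex R)); rewrite RRe_real ?ger0_real//.
by move/eqP; rewrite rmorph0 normr_eq0 => /eqP.
Qed.

End HilbertGeometry.

(** * Adjoints and operator norms *)

Section Adjoint.
Context (R : realType) (H : hilbertType R).
Implicit Types (x y z : H) (M : closedSubspace H) (T U : boundedOp H).

Definition proj M x : H := get [set m | M m /\ orthocomplement M (x - m)].

Lemma projP M x : M (proj M x) /\ orthocomplement M (x - proj M x).
Proof.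
have [m Mm xm] := orthogonal_projection M x.
by apply: (@getPex _ [set m | M m /\ orthocomplement M (x - m)]); exists m.
Qed.

Lemma orthocomplement_disjoint M x : M x -> orthocomplement M x -> x = 0.
Proof.
by move=> Mx /(_ _ Mx)/eqP; rewrite dnorm_eq0 => /eqP.
Qed.

Lemma proj_uniq M x m : M m -> orthocomplement M (x - m) -> proj M x = m.
Proof.
move=> Mm xm; have [Mp xp] := projP M x; apply/eqP; rewrite -subr_eq0; apply/eqP.
apply: (@orthocomplement_disjoint M); first exact: subspaceB.
have -> : proj M x - m = (x - m) - (x - proj M x) by rewrite opprB [RHS]addrC addrA subrK.
exact: subspaceB.
Qed.

Lemma proj_id M x : M x -> proj M x = x.
Proof. by move=> Mx; apply: proj_uniq => //; rewrite subrr; exact: subspace0. Qed.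

Lemma proj_linear M : linear (proj M).
Proof.
move=> a x y; have [Mx xp] := projP M x; have [My yp] := projP M y.
apply: proj_uniq; first exact/subspaceD/My/subspaceZ.
by rewrite opprD addrACA -scalerBr; exact/subspaceD/yp/subspaceZ.
Qed.

(** The bound in the definition of a bounded operator is a complex number, of
    which nothing else is known; its modulus is a real bound. *)
Lemma boundedOp_real T : exists2 c : R, 0 <= c & forall x, rnorm (T x) <= c * rnorm x.
Proof.
have [B TB] := boundedOpP T; exists (re `|B|).
  by rewrite -ler0c RRe_real// ger0_real.
move=> x; rewrite -lecR rmorphM/= RRe_real ?ger0_real// -!normE.
have h := TB x; apply: le_trans h _.
have : 0 <= B * `|x| by apply: le_trans (TB x).
by move/ger0_norm => <-; rewrite normrM normr_id.
Qed.

(** The representing vector spans the orthogonal complement of the kernel. *)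
Lemma riesz (phi : H -> R[i]) :
  (forall a x y, phi (a *: x + y) = a * phi x + phi y) -> continuous phi ->
  exists z, forall x, phi x = inner x z.
Proof.
move=> phiL phiC.
have phi0 : phi 0 = 0.
  have := phiL 1 0 0; rewrite scale1r addr0 mul1r => /eqP.
  by rewrite -subr_eq0 opprD addNKr oppr_eq0 => /eqP.
have phiZ a x : phi (a *: x) = a * phi x by have := phiL a x 0; rewrite phi0 !addr0.
have phiD x y : phi (x + y) = phi x + phi y by have := phiL 1 x y; rewrite scale1r mul1r.
have kerC : closed ([set x | phi x = 0] : set H).
  apply: (@preimage_closed _ R[i] phi [set 0]); first by move=> x _; exact: phiC.
  exact/accessible_closed_set1/hausdorff_accessible/norm_hausdorff.
have kerD x y : phi x = 0 -> phi y = 0 -> phi (x + y) = 0.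
  by move=> px py; rewrite phiD px py addr0.
have kerZ a x : phi x = 0 -> phi (a *: x) = 0.
  by move=> px; rewrite phiZ px mulr0.
pose K := @ClosedSubspace _ _ (fun x => phi x = 0) phi0 kerD kerZ kerC.
have [allK|/existsNP[x0 x0K]] := pselect (forall x, phi x = 0).
  by exists 0 => x; rewrite linear0r.
have [Kp up] := projP K x0; set u := x0 - proj K x0 in up.
have phiu : phi u != 0.
  apply/eqP => pu; apply: x0K; rewrite -(subrK (proj K x0) x0) -/u phiD pu add0r.
  exact: Kp.
have u0 : u != 0 by apply: contra phiu => /eqP ->; rewrite phi0.
have uu : 0 < inner u u by exact: neq0_dnorm_gt0.
have uR : Num.conj (inner u u) = inner u u by exact/conj_Creal/gtr0_real.
exists (Num.conj (phi u / inner u u) *: u) => x.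
rewrite linearZr_LR/= conjCK.
have : inner u (x - (phi x / phi u) *: u) = 0.
  by apply: up; rewrite /= -scaleNr addrC phiL; field.
move/inner_eq0_sym; rewrite linearBl/= linearZl_LR/= => /eqP.
by rewrite subr_eq0 => /eqP ->; field; rewrite phiu gt_eqF.
Qed.

Lemma inner_boundedOp_continuous T y : continuous (fun x => inner (T x) y).
Proof.
move=> x; have [c c0 Tc] := boundedOp_real T.
apply/cvgrPdist_lt => e e0; near=> z.
rewrite -linearBl/= -linearB/=; apply: le_lt_trans (inner_le _ _) _.
apply: (@le_lt_trans _ _ (`|x - z| * ((c%:C + 1) * (`|y| + 1)))).
  rewrite mulrA ler_pM//; last by rewrite lerDl.
  rewrite normE [in leRHS]normE mulrC -[1%R](rmorph1 (real_complex R)).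
  rewrite -rmorphD -rmorphM lecR; apply: le_trans (Tc _) _.
  by rewrite ler_wpM2r ?rnorm_ge0// lerDl.
rewrite -ltr_pdivlMr; last by rewrite mulr_gt0 ?ltr_wpDl ?ler0c.
near: z; apply: cvgr_dist_lt => //.
by rewrite divr_gt0// mulr_gt0 ?ltr_wpDl ?ler0c.
Unshelve. all: by end_near. Qed.

Lemma adjointE T x y : inner (T x) y = inner x (adjoint T y).
Proof.
suff /(@getPex _ [set z | forall x, inner (T x) y = inner x z]) : exists z,
  forall x, inner (T x) y = inner x z by apply.
apply: riesz (@inner_boundedOp_continuous T y).
by move=> a u v; rewrite linearP linearPl.
Qed.

Lemma adjointE' T x y : inner (adjoint T x) y = inner x (T y).
Proof. by rewrite innerC -adjointE -innerC. Qed.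

Lemma adjoint_uniq T y z :
  (forall x, inner (T x) y = inner x z) -> adjoint T y = z.
Proof. by move=> yz; apply: inner_eq => x; rewrite -adjointE. Qed.

Lemma adjoint_linear T : linear (adjoint T).
Proof.
by move=> a x y; apply: adjoint_uniq => u; rewrite !linearPr/= !adjointE.
Qed.

Lemma adjointB T x y : adjoint T (x - y) = adjoint T x - adjoint T y.
Proof.
by rewrite addrC -scaleN1r adjoint_linear scaleN1r addrC.
Qed.

Lemma reduces_orthocomplement T M : reduces T M -> reduces T (orthocomplement M).
Proof.
move=> [TM aM]; split=> x xp /= y My; first by rewrite adjointE; exact/xp/aM.
by rewrite adjointE'; exact/xp/TM.
Qed.

(** Testing both a subspace and its complement for invariance replaces the
    adjoint in the definition of reduction. *)
Lemma reduces_of_invariant T M : (forall x, M x -> M (T x)) ->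
  (forall x, orthocomplement M x -> orthocomplement M (T x)) -> reduces T M.
Proof.
move=> TM Tp; split=> // x Mx; have [Mm np] := projP M (adjoint T x).
set n := _ - _ in np; suff /eqP n0 : n = 0.
  by move: n0; rewrite subr_eq0 => /eqP ->.
apply/eqP; rewrite -(@dnorm_eq0 _ _ (@inner R H)).
rewrite {2}/n linearBr/= (np _ Mm) subr0 -adjointE.
by rewrite (Tp _ np _ Mx).
Qed.

Lemma opnorm_ub (f : H -> H) (c : R) x : (forall x, rnorm (f x) <= c * rnorm x) ->
  0 <= c -> `|x| <= 1 -> rnorm (f x) <= opnorm f.
Proof.
move=> fc c0 x1; apply: ub_le_sup; last by exists x.
exists c => _ [y /= y1 <-]; apply: le_trans (fc y) _.
by rewrite ler_piMr// -lecR -normE rmorph1.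
Qed.

Lemma le_opnorm (f : H -> H) (c : R) : (forall x, rnorm (f x) <= c * rnorm x) ->
  0 <= c -> (forall a x, f (a *: x) = a *: f x) ->
  forall x, rnorm (f x) <= opnorm f * rnorm x.
Proof.
move=> fc c0 fZ x; have [->|x0] := eqVneq x 0.
  have -> : f 0 = 0 by rewrite -(scale0r (0 : H)) fZ !scale0r.
  by rewrite /rnorm normr0 mulr0.
have nx : 0 < rnorm x by rewrite -ltcR -normE normr_gt0.
have := @opnorm_ub f c ((rnorm x)^-1%:C *: x) fc c0.
rewrite fZ rnormZ ?invr_ge0 ?rnorm_ge0// mulrC ler_pdivrMr//; apply.
by rewrite normE rnormZ ?invr_ge0 ?rnorm_ge0// mulVf ?gt_eqF.
Qed.

Lemma opnorm_le (f : H -> H) (c : R) :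
  (forall x, `|x| <= 1 -> rnorm (f x) <= c) -> opnorm f <= c.
Proof.
move=> fc; apply: ge_sup; first by exists (rnorm (f 0)); exists 0; rewrite //= normr0.
by move=> _ [x x1 <-]; exact: fc.
Qed.

End Adjoint.

Section Restriction.
Context (R : realType) (H : hilbertType R) (M : closedSubspace H).
Variables (T : boundedOp H) (T' : boundedOp (subHilbert M)).
Hypotheses (TM : reduces T M) (valT' : forall x, val (T' x) = T (val x)).

(** The vector that represents the functional in the whole space lies in the
    subspace by reduction, so it represents the restricted functional there. *)
Lemma val_adjoint x : val (adjoint T' x) = adjoint T (val x).
Proof.
have Mx : M (adjoint T (val x)) by apply: TM.2; exact: subHilbertP.
pose a : subHilbert M := exist _ (adjoint T (val x)) (mem_set Mx).
rewrite (@adjoint_uniq _ _ T' x a)// => z.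
by have := adjointE T (val z) (val x); rewrite -valT'.
Qed.

End Restriction.

(** * The unitary part of an operator *)

Section UnitaryPart.
Context (R : realType) (H : hilbertType R) (P : boundedOp H).
Implicit Types (x y z : H) (M N : closedSubspace H) (S : set H).

Local Notation Q := (adjoint P).

Section Annihilator.
Variable S : set H.

Let ann : set H := [set x | forall y, S y -> inner x y = 0].

Fact ann0 : ann 0. Proof. by move=> y _; rewrite linear0l. Qed.

Fact annD x y : ann x -> ann y -> ann (x + y).
Proof. by move=> ax ay z Sz; rewrite linearDl/= ax// ay// addr0. Qed.

Fact annZ (a : R[i]) x : ann x -> ann (a *: x).
Proof. by move=> ax z Sz; rewrite linearZl_LR/= ax// mulr0. Qed.

Fact ann_closed : closed ann.
Proof.
have -> : ann = \bigcap_(y in S) [set x | inner x y = 0] by apply/seteqP; split => x.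
apply: closed_bigI => y _.
apply: (@preimage_closed _ R[i] (fun x => inner x y) [set 0]).
  by move=> x _; exact: inner_continuousl.
exact/accessible_closed_set1/hausdorff_accessible/norm_hausdorff.
Qed.

Definition annihilator : closedSubspace H := ClosedSubspace ann0 annD annZ ann_closed.

End Annihilator.

(** The unitary part is written as the annihilator of these vectors, which
    makes it a closed subspace at once; they come from moving all the operators
    in the equations of [unitary_partP] to the other side of the inner product. *)
Definition unitary_defects : set H :=
  [set v | exists n z, v = iter n Q (Q (P z) - z) \/ v = iter n P (P (Q z) - z)].

Definition unitary_part : closedSubspace H := annihilator unitary_defects.

Lemma iter_adjointE n x y : inner (iter n P x) y = inner x (iter n Q y).
Proof. by elim: n x y => // n IH x y; rewrite iterS iterSr adjointE IH. Qed.

Lemma iter_adjointE' n x y : inner (iter n Q x) y = inner x (iter n P y).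
Proof. by rewrite innerC -iter_adjointE -innerC. Qed.

Lemma unitary_partP x : unitary_part x <->
  forall n, Q (P (iter n P x)) = iter n P x /\ P (Q (iter n Q x)) = iter n Q x.
Proof.
have defectl z y : inner (Q (P z) - z) y = inner z (Q (P y) - y).
  by rewrite linearBl linearBr/= adjointE' adjointE.
have defectr z y : inner (P (Q z) - z) y = inner z (P (Q y) - y).
  by rewrite linearBl linearBr/= adjointE adjointE'.
split=> [Ux n|Ux /= y [n [z [->|->]]]]; last 2 first.
- by rewrite -iter_adjointE; apply: inner_eq0_sym; rewrite defectl (Ux n).1 subrr linear0r.
- by rewrite -iter_adjointE'; apply: inner_eq0_sym; rewrite defectr (Ux n).2 subrr linear0r.
split; apply/eqP; rewrite -subr_eq0; apply/eqP/inner_eq => z; rewrite linear0r.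
  rewrite -defectl; apply: inner_eq0_sym; rewrite iter_adjointE.
  by apply: Ux; exists n, z; left.
rewrite -defectr; apply: inner_eq0_sym; rewrite iter_adjointE'.
by apply: Ux; exists n, z; right.
Qed.

Lemma unitary_partPK x : unitary_part x -> Q (P x) = x.
Proof. by move/unitary_partP/(_ 0%N) => -[]. Qed.

Lemma unitary_partQK x : unitary_part x -> P (Q x) = x.
Proof. by move/unitary_partP/(_ 0%N) => -[]. Qed.

Lemma unitary_part_reduces : reduces P unitary_part.
Proof.
split=> x Ux; have UP := (unitary_partP x).1 Ux; apply/unitary_partP => n.
  split; first by rewrite -iterSr (UP n.+1).1.
  case: n => [|n]; first by rewrite /= (unitary_partPK Ux).
  by rewrite [iter _ Q _]iterSr (unitary_partPK Ux) (UP n).2.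
split; last by rewrite -iterSr (UP n.+1).2.
case: n => [|n]; first by rewrite /= (unitary_partQK Ux).
by rewrite [iter _ P _]iterSr (unitary_partQK Ux) (UP n).1.
Qed.

(** The form in which the maximality of the unitary part is used: [A] is a mere
    set of vectors, such as the image of a subspace under an operator. *)
Lemma isometry_orbit_in_unitary_part (A : H -> Prop) :
  (forall x, A x -> [/\ A (P x), A (Q x), Q (P x) = x & P (Q x) = x]) ->
  forall x, A x -> unitary_part x.
Proof.
move=> AP x Ax; apply/unitary_partP => n.
have [AnP AnQ] : A (iter n P x) /\ A (iter n Q x).
  by elim: n => // n [/AP[+ _ _ _] /AP[_ + _ _]]; split.
by have [_ _ -> _] := AP _ AnP; have [_ _ _ ->] := AP _ AnQ.
Qed.

Lemma unitary_onP N : unitary_on P N <->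
  reduces P N /\ forall x, N x -> Q (P x) = x /\ P (Q x) = x.
Proof.
split=> [[PN [QPK PQK]]|[PN NP]].
  have aE := val_adjoint PN (T' := restr PN) (fun=> erefl).
  split=> // x Nx; pose y : subHilbert N := exist _ x (mem_set Nx).
  split; first by have := congr1 val (QPK y); rewrite aE.
  by have := congr1 val (PQK y); rewrite /= aE.
exists PN; have aE := val_adjoint PN (T' := restr PN) (fun=> erefl).
split=> x; apply: val_inj; have [QPK PQK] := NP _ (subHilbertP x).
  by rewrite aE.
by rewrite /= aE.
Qed.

Theorem unitary_part_maximal : maximal_unitary_subspace P unitary_part.
Proof.
split.
  apply/unitary_onP; split; first exact: unitary_part_reduces.
  by move=> x Ux; rewrite unitary_partPK// unitary_partQK.
move=> N /unitary_onP[[PN QN] NP]; apply: isometry_orbit_in_unitary_part => x Nx.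
by have [] := NP _ Nx; split=> //; [exact: PN|exact: QN].
Qed.

End UnitaryPart.

(** * Polynomials in commuting operators *)

Section PolynomialCalculus.
Context (R : realType) (H : hilbertType R) (n : nat) (T : 'I_n -> boundedOp H).
Implicit Types (x y : H) (M : closedSubspace H) (p q : mpoly n R[i]).

Lemma monomial_op_linear m a x y :
  monomial_op T m (a *: x + y) = a *: monomial_op T m x + monomial_op T m y.
Proof.
rewrite /monomial_op; elim/big_ind : _ a x y => //.
- by move=> f g fl gl a x y /=; rewrite gl fl.
- by move=> i _ a x y; elim: (m i) => //= k ->; rewrite linearP.
Qed.

Lemma poly_op_linear p a x y :
  poly_op T p (a *: x + y) = a *: poly_op T p x + poly_op T p y.
Proof.
rewrite /poly_op scaler_sumr -big_split/=; apply: eq_bigr => m _.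
by rewrite monomial_op_linear scalerDr !scalerA mulrC.
Qed.

Lemma poly_op0 p : poly_op T p 0 = 0.
Proof.
apply/eqP; have := poly_op_linear p 1 0 0; rewrite !scale1r addr0 => /eqP.
by rewrite -subr_eq0 opprD addNKr oppr_eq0.
Qed.

Lemma poly_opZr p a x : poly_op T p (a *: x) = a *: poly_op T p x.
Proof. by have := poly_op_linear p a x 0; rewrite poly_op0 !addr0. Qed.

Lemma poly_op_bounded p :
  exists2 c : R, 0 <= c & forall x, rnorm (poly_op T p x) <= c * rnorm x.
Proof.
rewrite /poly_op.
have mono m : exists2 c : R, 0 <= c & forall x, rnorm (monomial_op T m x) <= c * rnorm x.
  rewrite /monomial_op; elim/big_ind : _ => //.
  - by exists 1 => // x; rewrite mul1r.
  - move=> f g [c c0 fc] [d d0 gd]; exists (c * d); rewrite ?mulr_ge0// => x.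
    by apply: le_trans (fc _) _; rewrite -mulrA ler_wpM2l.
  - move=> i _; elim: (m i) => /= [|k [c c0 IH]]; first by exists 1 => // x; rewrite mul1r.
    have [d d0 Td] := boundedOp_real (T i); exists (d * c); rewrite ?mulr_ge0// => x.
    by apply: le_trans (Td _) _; rewrite -mulrA ler_wpM2l.
elim: (msupp p) => [|m s [c c0 IH]].
  by exists 0 => // x; rewrite big_nil /rnorm normr0 mul0r.
have [d d0 md] := mono (fun_of_multinom m).
have a0 : 0 <= re `|mcoeff m p| by rewrite -ler0c RRe_real// ger0_real.
exists (re `|mcoeff m p| * d + c) => [|x].
  by rewrite addr_ge0// mulr_ge0.
rewrite big_cons; apply: le_trans (rnormD _ _) _.
by rewrite mulrDl lerD// rnormZc -mulrA ler_wpM2l.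
Qed.

Lemma poly_op_invariant M p : (forall i x, M x -> M (T i x)) ->
  forall x, M x -> M (poly_op T p x).
Proof.
move=> TM x Mx; rewrite /poly_op; elim/big_ind : _.
- exact: subspace0.
- by move=> u v; exact: subspaceD.
move=> m _; apply: subspaceZ; move: x Mx; rewrite /monomial_op.
elim/big_ind : _ => //; first by move=> f g fM gM x Mx /=; exact/fM/gM.
by move=> i _ x Mx; elim: (fun_of_multinom m i) => //= k; exact: TM.
Qed.

(** Sums over a common list of multi-indices make the polynomial calculus
    additive although supports do not add up. *)
Lemma poly_op_widen p (s : seq (multinom n)) x :
  uniq s -> {subset msupp p <= s} ->
  poly_op T p x =
  \sum_(m <- s) mcoeff m p *: monomial_op T (fun_of_multinom m) x.
Proof.
move=> us ps; rewrite (bigID (mem (msupp p)))/= [X in _ + X]big1 ?addr0; last first.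
  by move=> m; rewrite -mcoeff_eq0 => /eqP ->; rewrite scale0r.
rewrite -big_filter /poly_op; apply: perm_big; apply: uniq_perm.
- exact: msupp_uniq.
- exact: filter_uniq.
move=> m; rewrite mem_filter /=; case: (boolP (m \in _)) => //= mp.
by rewrite ps.
Qed.

Lemma poly_opD p q x : poly_op T (p + q) x = poly_op T p x + poly_op T q x.
Proof.
pose s := undup (msupp p ++ msupp q).
rewrite !(@poly_op_widen _ s) ?undup_uniq//.
- by rewrite -big_split; apply: eq_bigr => m _; rewrite mcoeffD scalerDl.
- by move=> m mq; rewrite mem_undup mem_cat mq orbT.
- by move=> m mq; rewrite mem_undup mem_cat mq.
- by move=> m /msuppD_le; rewrite mem_undup.
Qed.

Lemma poly_opZ a p x : poly_op T (a *: p) x = a *: poly_op T p x.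
Proof.
rewrite (@poly_op_widen _ (msupp p)) ?msupp_uniq//; last first.
  exact: msuppZ_le.
by rewrite scaler_sumr; apply: eq_bigr => m _; rewrite mcoeffZ scalerA.
Qed.

Lemma poly_op1 x : poly_op T 1 x = x.
Proof.
rewrite /poly_op msupp1 big_seq1 mcoeff1 eqxx scale1r /monomial_op.
by elim/big_ind : _ => //= [f g fi gi|i _]; rewrite ?gi// mnm0E.
Qed.

Lemma poly_op_var i x : poly_op T (mpolyX R[i] (mnm1 i)) x = T i x.
Proof.
rewrite /poly_op msuppX big_seq1 mcoeffX eqxx scale1r /monomial_op.
suff -> (r : seq 'I_n) : uniq r ->
    (\big[(fun f g : H -> H => f \o g)/id]_(j <- r) iter (mnm1 i j) (T j)) x =
    if i \in r then T i x else x.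
  by rewrite mem_index_enum.
  exact: index_enum_uniq.
elim: r => [|j r IH] /=; first by rewrite big_nil.
move=> /andP[jr ur]; rewrite big_cons /= IH// in_cons mnm1E.
by have [ij|//] := eqVneq i j; rewrite ij (negPf jr).
Qed.

(** An inequality between the moduli of two polynomials on [X] says that their
    quotient is bounded by 1 there; the inverse of [q(T)] disappears after
    the substitution of [q(T) x] for the vector. *)
Lemma spectral_set_le (X : set 'rV[R[i]]_n) p q : spectral_set X T -> X !=set0 ->
  (forall z, X z -> peval q z != 0) ->
  (forall z, X z -> `|peval p z| <= `|peval q z|) ->
  forall x, rnorm (poly_op T p x) <= rnorm (poly_op T q x).
Proof.
move=> [_ _ _ /(_ p q)h] [z0 Xz0] q0 pq x.
have [Q [_ QK pQ]] := h q0.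
have [c c0 pc] := poly_op_bounded p; have [d d0 Qd] := boundedOp_real Q.
rewrite -{1}(QK x); apply: le_trans (_ : opnorm (poly_op T p \o Q) * _ <= _).
  apply: (@le_opnorm _ _ (poly_op T p \o Q) (c * d)); rewrite ?mulr_ge0//.
    by move=> y; apply: le_trans (pc _) _; rewrite -mulrA ler_wpM2l.
  by move=> a y; rewrite /= linearZ poly_opZr.
rewrite ler_piMl ?rnorm_ge0//; apply: le_trans pQ _; apply: ge_sup.
  by exists (rnorm (peval p z0 / peval q z0)), z0.
move=> _ [z Xz <-]; rewrite -lecR -normE normrM normfV rmorph1.
by rewrite ler_pdivrMr ?normr_gt0 ?q0// mul1r pq.
Qed.

End PolynomialCalculus.

(** * Two inequalities on the symmetrized tridisc *)

Section ScalarInequalities.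
Context (R : realType).
Implicit Types (z w s : R[i]).

(** With [z = a + i b] and [w = c + i d] this is
    [|1 + z|^2 |1 - w|^2 + |1 + w|^2 |1 - z|^2 + 4 Im z Im w]. *)
Let cross (a b c d : R) : R :=
  ((1 + a) ^+ 2 + b ^+ 2) * ((1 - c) ^+ 2 + d ^+ 2) +
  ((1 + c) ^+ 2 + d ^+ 2) * ((1 - a) ^+ 2 + b ^+ 2) + 4 * b * d.

Let cross_ge0 a b c d : 0 <= cross a b c d.
Proof.
rewrite (_ : cross a b c d = ((1 + a) * (1 - c)) ^+ 2 + ((1 + c) * (1 - a)) ^+ 2 +
  2 * (b * d) ^+ 2 + 2 * (a * d) ^+ 2 + 2 * (b * c) ^+ 2 + 2 * (b + d) ^+ 2).
    by rewrite !addr_ge0 ?sqr_ge0// mulr_ge0 ?sqr_ge0.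
by rewrite /cross; ring.
Qed.

Lemma normc_le1 (a b : R) : `|a +i* b| <= 1 -> 0 <= 1 - a ^+ 2 - b ^+ 2.
Proof.
rewrite -(@ler_sqr _ `|_|) ?nnegrE// -add_Re2_Im2 -(rmorph1 (real_complex R)).
by rewrite -rmorphXn lecR /= expr1n -addrA -opprD subr_ge0.
Qed.

Lemma le_normc (z w : R[i]) :
  re z ^+ 2 + complex.Im z ^+ 2 <= re w ^+ 2 + complex.Im w ^+ 2 -> `|z| <= `|w|.
Proof. by move=> zw; rewrite -ler_sqr ?nnegrE// -!add_Re2_Im2 lecR. Qed.

(** Under the Cayley transforms [h_i = (1 + z_i) / (1 - z_i)], with elementary
    symmetric functions [e1] and [e2], the inequality becomes
    [0 <= Re (conj e1 * (e2 + 3))], and the expansion of this real part in the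
    real and imaginary parts of the [h_i] consists of terms that are nonnegative
    when [Re h_i >= 0]. Clearing the denominators gives an identity that also
    covers [z_i = 1]: the difference of the squared moduli is
    a combination of the numbers [1 - |z_i|^2] with nonnegative coefficients. *)
Lemma symm3_pencil1 z1 z2 z3 : `|z1| <= 1 -> `|z2| <= 1 -> `|z3| <= 1 ->
  `|3 * (z1 * z2 * z3) - (z1 * z2 + z2 * z3 + z3 * z1)| <= `|3 - (z1 + z2 + z3)|.
Proof.
case: z1 z2 z3 => a1 b1 [a2 b2] [a3 b3] /normc_le1 X1 /normc_le1 X2 /normc_le1 X3.
apply: le_normc; rewrite -subr_ge0 /=.
pose q (a b : R) := (1 - a) ^+ 2 + b ^+ 2.
rewrite [leRHS](_ : _ = 2^-1 * (
  (1 - a1 ^+ 2 - b1 ^+ 2) * (cross a2 b2 a3 b3 + 3 * (q a2 b2 * q a3 b3)) +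
  (1 - a2 ^+ 2 - b2 ^+ 2) * (cross a1 b1 a3 b3 + 3 * (q a1 b1 * q a3 b3)) +
  (1 - a3 ^+ 2 - b3 ^+ 2) * (cross a1 b1 a2 b2 + 3 * (q a1 b1 * q a2 b2)) +
  3 * ((1 - a1 ^+ 2 - b1 ^+ 2) * (1 - a2 ^+ 2 - b2 ^+ 2) *
       (1 - a3 ^+ 2 - b3 ^+ 2)))); last by rewrite /cross /q; field.
have q0 a b : 0 <= q a b by rewrite addr_ge0 ?sqr_ge0.
have term (X c e : R) : 0 <= X -> 0 <= c -> 0 <= e -> 0 <= X * (c + 3 * e).
  by move=> *; rewrite mulr_ge0 ?addr_ge0 ?mulr_ge0.
apply: mulr_ge0; first by rewrite invr_ge0.
apply: addr_ge0; last by rewrite !mulr_ge0.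
apply: addr_ge0; first apply: addr_ge0.
all: by apply: term => //; exact: mulr_ge0.
Qed.

(** In the notation of the Cayley transforms this is
    [0 <= Re (conj e1 * e2)]. *)
Lemma symm3_pencil2 z1 z2 z3 : `|z1| <= 1 -> `|z2| <= 1 -> `|z3| <= 1 ->
  `|3 * (z1 * z2 * z3) - (z1 + z2 + z3)| <= `|3 - (z1 * z2 + z2 * z3 + z3 * z1)|.
Proof.
case: z1 z2 z3 => a1 b1 [a2 b2] [a3 b3] /normc_le1 X1 /normc_le1 X2 /normc_le1 X3.
apply: le_normc; rewrite -subr_ge0 /=.
rewrite [leRHS](_ : _ =
  (1 - a1 ^+ 2 - b1 ^+ 2) * cross a2 b2 a3 b3 +
  (1 - a2 ^+ 2 - b2 ^+ 2) * cross a1 b1 a3 b3 +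
  (1 - a3 ^+ 2 - b3 ^+ 2) * cross a1 b1 a2 b2 +
  3 * ((1 - a1 ^+ 2 - b1 ^+ 2) * (1 - a2 ^+ 2 - b2 ^+ 2) *
       (1 - a3 ^+ 2 - b3 ^+ 2))); last by rewrite /cross; ring.
apply: addr_ge0; last by rewrite !mulr_ge0.
apply: addr_ge0; first apply: addr_ge0.
all: exact: mulr_ge0.
Qed.

End ScalarInequalities.

(** * Operator pencils *)

Section SpectralPencil.
Context (R : realType) (H : hilbertType R).
Implicit Types (x y : H) (w : R[i]).

Lemma dist3_le (u : R[i]) (e : R) : `|u| <= 3 -> 0 <= e -> `|3 - u| <= `|3 + e%:C - u|.
Proof.
case: u => a b u3 e0; apply: le_normc => /=; rewrite !addr0 lerD2r.
have a3 : a <= 3.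
  rewrite -lecR; apply: le_trans (_ : `|a|%:C <= _); first by rewrite lecR ler_norm.
  by apply: le_trans (normc_ge_Re (a +i* b)) _; apply: le_trans u3 _; rewrite rmorph_nat.
by rewrite ler_sqr ?nnegrE; lra.
Qed.

(** The denominator [3 - w z_a] may vanish on [X]; it does not after adding a
    small [e > 0], which does not decrease its modulus. *)
Lemma spectral_pencil_le n (T : 'I_n -> boundedOp H) (X : set 'rV[R[i]]_n) a b c w :
  spectral_set X T -> X !=set0 -> `|w| = 1 ->
  (forall z, X z -> `|z ord0 a| <= 3) ->
  (forall z, X z -> `|3 * w * z ord0 c - z ord0 b| <= `|3 - w * z ord0 a|) ->
  forall y, rnorm ((3 * w) *: T c y - T b y) <= rnorm (3 *: y - w *: T a y).
Proof.
move=> XT X0 w1 Xa Xle y; apply/ler_addgt0Pr => d d0.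
pose e := d / (rnorm y + 1).
have y1 : 0 < rnorm y + 1 by rewrite ltr_wpDl ?rnorm_ge0.
have e0 : 0 < e by rewrite divr_gt0.
pose v i : mpoly n R[i] := mpolyX R[i] (mnm1 i).
pose p := (3 * w) *: v c + (-1) *: v b.
pose q := (3 + e%:C) *: 1 + (- w) *: v a.
have pE z : peval p z = 3 * w * z ord0 c - z ord0 b.
  by rewrite /peval mevalD !mevalZ !mevalXU mulN1r.
have qE z : peval q z = 3 + e%:C - w * z ord0 a.
  by rewrite /peval mevalD !mevalZ mevalXU meval1 mulr1 mulNr.
have wz z : X z -> `|w * z ord0 a| <= 3 by move=> /Xa; rewrite normrM w1 mul1r.
have -> : (3 * w) *: T c y - T b y = poly_op T p y.
  by rewrite poly_opD !poly_opZ !poly_op_var scaleN1r.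
apply: le_trans (spectral_set_le XT X0 (q := q) _ _ y) _.
- move=> z Xz; rewrite qE subr_eq0; apply/eqP => /(congr1 (fun u => `|u|)).
  apply/eqP; rewrite gt_eqF//; apply: le_lt_trans (wz _ Xz) _.
  by rewrite ger0_norm ?addr_ge0 ?ler0c ?ltW// ltrDl ltcR.
- move=> z Xz; rewrite pE qE; apply: le_trans (Xle _ Xz) _.
  exact: dist3_le (wz _ Xz) (ltW e0).
rewrite poly_opD !poly_opZ poly_op_var poly_op1 scaleNr scalerDl addrAC.
apply: le_trans (rnormD _ _) _.
rewrite lerD2l rnormZ; last exact: ltW.
rewrite /e mulrAC ler_pdivrMr// ler_pM2l//.
by rewrite lerDl.
Qed.

Lemma Gamma3_neq0 : @Gamma3 R !=set0.
Proof. by exists (symm3 0 0 0); exists 0, 0, 0; rewrite normr0; split. Qed.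

(** The first inequality is the scalar one at the points [w z_i], divided by
    [w^2]. In the second one the roots are rotated by a square root [v] of [w],
    so that [s2] is multiplied by [w]. *)
Lemma Gamma3_contraction_pencils (S1 S2 P : boundedOp H) : Gamma3_contraction S1 S2 P ->
  forall w, `|w| = 1 -> forall y,
    rnorm ((3 * w) *: P y - S2 y) <= rnorm (3 *: y - w *: S1 y) /\
    rnorm ((3 * w) *: P y - S1 y) <= rnorm (3 *: y - w *: S2 y).
Proof.
move=> GT w w1 y.
pose i0 : 'I_3 := ord0; pose i1 : 'I_3 := lift ord0 ord0; pose i2 : 'I_3 := ord_max.
have s1 z1 z2 z3 : symm3 z1 z2 z3 ord0 i0 = z1 + z2 + z3 :> R[i] by rewrite mxE.
have s2 z1 z2 z3 : symm3 z1 z2 z3 ord0 i1 = z1 * z2 + z2 * z3 + z3 * z1 :> R[i].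
  by rewrite mxE.
have p z1 z2 z3 : symm3 z1 z2 z3 ord0 i2 = z1 * z2 * z3 :> R[i] by rewrite mxE.
have norm3 (a b c : R[i]) : `|a| <= 1 -> `|b| <= 1 -> `|c| <= 1 -> `|a + b + c| <= 3.
  move=> a1 b1 c1; have -> : 3 = 1 + 1 + 1 :> R[i] by ring.
  apply: le_trans (ler_normD _ _) (lerD _ c1).
  exact: le_trans (ler_normD _ _) (lerD a1 b1).
have normM (a b : R[i]) : `|a| <= 1 -> `|b| <= 1 -> `|a * b| <= 1.
  by move=> a1 b1; rewrite normrM mulr_ile1.
have normM1 (u a : R[i]) : `|u| = 1 -> `|u * a| = `|a|.
  by rewrite normrM => ->; rewrite mul1r.
split.
  apply: (spectral_pencil_le (a := i0) (b := i1) (c := i2) GT Gamma3_neq0 w1).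
    by move=> _ [z1 [z2 [z3 [h1 h2 h3 ->]]]]; rewrite s1; exact: norm3.
  move=> _ [z1 [z2 [z3 [h1 h2 h3 ->]]]]; rewrite s1 s2 p.
  have wz z : `|z| <= 1 -> `|w * z| <= 1 by rewrite normrM w1 mul1r.
  have := symm3_pencil1 (wz _ h1) (wz _ h2) (wz _ h3).
  rewrite -!mulrDr; congr (_ <= _).
  have w2 : `|w ^+ 2| = 1 by rewrite normrX w1 expr1n.
  by rewrite -[RHS](normM1 _ _ w2); congr `|_|; ring.
apply: (spectral_pencil_le (a := i1) (b := i0) (c := i2) GT Gamma3_neq0 w1).
  by move=> _ [z1 [z2 [z3 [h1 h2 h3 ->]]]]; rewrite s2; apply: norm3; exact: normM.
move=> _ [z1 [z2 [z3 [h1 h2 h3 ->]]]]; rewrite s1 s2 p.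
pose v := sqrtC w.
have v2 : v ^+ 2 = w by exact: sqrtCK.
have v1 : `|v| = 1.
  by apply/eqP; rewrite -(@pexpr_eq1 _ _ 2)// -normrX v2 w1.
have vz z : `|z| <= 1 -> `|v * z| <= 1 by rewrite normrM v1 mul1r.
have := symm3_pencil2 (vz _ h1) (vz _ h2) (vz _ h3).
rewrite -v2; congr (_ <= _); last by congr `|_|; ring.
by rewrite -[RHS](normM1 _ _ v1); congr `|_|; ring.
Qed.

End SpectralPencil.

(** * The fundamental equations *)

Section FundamentalEquations.
Context (R : realType) (H : hilbertType R).
Implicit Types (x y z : H) (w t : R[i]) (A B P : boundedOp H).

Local Notation "z ^*" := (Num.conj z).

Lemma rotations_npos_eq0 (c : R[i]) :
  (forall w, `|w| = 1 -> w * c + (w * c)^* <= 0) -> c = 0.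
Proof.
move=> h; have [//|c0] := eqVneq c 0.
have n0 : `|c| != 0 by rewrite normr_eq0.
have := h (c^* / `|c|).
rewrite normrM normfV normr_id norm_conjC divff// => /(_ erefl).
have -> : c^* / `|c| * c = `|c|.
  by rewrite mulrAC [c^* * c]mulrC -normCK expr2 mulfK.
rewrite conj_Creal ?normr_real// -mulr2n pmulrn_lle0// normr_le0.
by rewrite (negPf c0).
Qed.

Lemma ray_bounded_npos (c M : R[i]) :
  (forall s : R[i], 0 < s -> s * (c + c^*) <= M) -> c + c^* <= 0.
Proof.
move=> h; set L := c + c^*; have LR : L \is Num.real.
  by rewrite CrealE rmorphD/= conjCK addrC.
rewrite real_leNgt ?real0//; apply/negP => L0.
have := h ((`|M| + 1) / L); rewrite -/L divfK ?gt_eqF//.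
move/(_ (divr_gt0 (ltr_wpDl (normr_ge0 _) ltr01) L0)) => hM.
have M0 : 0 <= M by apply: le_trans hM; rewrite addr_ge0.
by move: hM; rewrite ger0_norm// gerDl ler10.
Qed.

Definition defect P y : R[i] := inner y y - inner (P y) (P y).

(** The difference of the squares of both sides. The coefficients of [w] combine
    into the form of [A - B* P]. *)
Lemma pencil_form A B P w y : `|w| = 1 ->
  rnorm ((3 * w) *: P y - B y) <= rnorm (3 *: y - w *: A y) ->
  0 <= 9 * defect P y + inner (A y) (A y) - inner (B y) (B y) -
    3 * (w * (inner (A y) y - inner (P y) (B y)) +
         (w * (inner (A y) y - inner (P y) (B y)))^*).
Proof.
move=> w1; rewrite -ler_sqr ?nnegrE ?rnorm_ge0// -lecR !rmorphXn/= -!normE !inner_norm.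
rewrite -subr_ge0; congr (0 <= _).
rewrite !dnormB !dnormZ !linearZr_LR/= !linearZl_LR/= normrM w1 mulr1 /defect.
have -> : inner y (A y) = (inner (A y) y)^* by rewrite innerC.
have n3 : `|3 : R[i]| = 3 by rewrite ger0_norm.
have c3 : (3 : R[i])^* = 3 by rewrite conj_Creal// realn.
rewrite !(rmorphB, rmorphM)/= !conjCK n3 c3 -[3 *: (w * _)]/(3 * (w * _)).
by ring.
Qed.

(** Averaging the second inequality over [w = 1] and [w = -1] removes its
    linear term, and adding the first one removes the norms of [A y] and
    [B y], on which there is no other control. *)
Lemma fundamental_form A B P :
  (forall w, `|w| = 1 -> forall y,
    rnorm ((3 * w) *: P y - B y) <= rnorm (3 *: y - w *: A y) /\
    rnorm ((3 * w) *: P y - A y) <= rnorm (3 *: y - w *: B y)) ->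
  forall w y, `|w| = 1 ->
    w * (inner (A y) y - inner (P y) (B y)) +
      (w * (inner (A y) y - inner (P y) (B y)))^* <= 6 * defect P y.
Proof.
move=> h w y w1.
have /(pencil_form w1) f0 := (h _ w1 y).1.
have n1 : `|1 : R[i]| = 1 by rewrite normr1.
have n1N : `|- 1 : R[i]| = 1 by rewrite normrN1.
have /(pencil_form n1) f1 := (h _ n1 y).2.
have /(pencil_form n1N) f2 := (h _ n1N y).2.
rewrite -subr_ge0 -(@pmulr_rge0 _ 6)//.
have := addr_ge0 (addr_ge0 f0 f0) (addr_ge0 f1 f2); congr (0 <= _).
by rewrite !rmorphM/= rmorphN1 rmorph1; ring.
Qed.

(** For [x] fixed by [P* P] the defect of [t x + z] does not depend on [t], while
    the dominated form grows with [t] unless its values at [(x, z)] and [(z, x)]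
    are 0; the two equations say that these values are 0 for all [z]. *)
Lemma fundamental_equations A B P :
  (forall w y, `|w| = 1 ->
    w * (inner (A y) y - inner (P y) (B y)) +
      (w * (inner (A y) y - inner (P y) (B y)))^* <= 6 * defect P y) ->
  forall x, adjoint P (P x) = x ->
    A x = adjoint B (P x) /\ adjoint A x = adjoint P (B x).
Proof.
move=> h x Px.
have scaleE (a c : R[i]) : a *: (c : R[i]^o) = a * c by [].
pose b u v := inner (A u) v - inner (P u) (B v).
have bD t u v : b (t *: u + v) (t *: u + v) =
    t * t^* * b u u + t * b u v + t^* * b v u + b v v.
  rewrite /b !(linearP A) !(linearP P) !(linearP B).
  rewrite !(linearDl, linearDr)/= !(linearZl_LR, linearZr_LR)/=.
  by rewrite !scaleE; ring.
have dx u v : inner (P u) (P v) = inner u (adjoint P (P v)) by rewrite adjointE.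
have dD t z : defect P (t *: x + z) = defect P z.
  have zx : inner (P z) (P x) = inner z x by rewrite dx Px.
  have xx : inner (P x) (P x) = inner x x by rewrite dx Px.
  have xz : inner (P x) (P z) = inner x z by rewrite innerC zx -innerC.
  rewrite /defect (linearP P) !(linearDl, linearDr)/= !(linearZl_LR, linearZr_LR)/=.
  by rewrite zx xx xz !scaleE; ring.
have bxx : b x x = 0.
  apply: rotations_npos_eq0 => w w1; apply: le_trans (h w x w1) _.
  by rewrite /defect dx Px subrr mulr0.
have bxz t z : t * b x z + t^* * b z x = 0.
  apply: rotations_npos_eq0 => w w1.
  pose M := 6 * defect P z - (w * b z z + (w * b z z)^*).
  apply: (@ray_bounded_npos _ M) => s s0.
  rewrite -subr_ge0; have := h w ((s * t) *: x + z) w1.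
  rewrite -!/(b _ _) bD dD bxx -subr_ge0; congr (0 <= _).
  rewrite /M !(rmorphM, rmorphD, rmorph0)/= !conjCK.
  by rewrite (conj_Creal (gtr0_real s0)); ring.
have b0 z : b x z = 0 /\ b z x = 0.
  have := bxz 1 z; rewrite rmorph1 !mul1r => /eqP; rewrite addr_eq0 => /eqP e1.
  (* [t = 1] and [t = 'i] separate the linear and the conjugate linear term. *)
  have := bxz 'i z; rewrite conjCi e1 mulrN mulNr -opprD -mulrDr => /eqP.
  rewrite oppr_eq0 mulf_eq0 eq_complex /= oner_eq0 andbF -mulr2n mulrn_eq0 /=.
  by move/eqP => e2; rewrite e2 oppr0.
split; apply: inner_eq => z.
  have /eqP := (b0 z).1; rewrite subr_eq0 => /eqP e.
  by rewrite innerC e -innerC adjointE.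
by have /eqP := (b0 z).2; rewrite subr_eq0 !adjointE => /eqP.
Qed.

End FundamentalEquations.

(** * Consequences on the unitary part *)

Section ReducingSubspace.
Context (R : realType) (H : hilbertType R).
Variables (A B P : boundedOp H).
Local Notation U := (unitary_part P).

Hypothesis AP : forall x, A (P x) = P (A x).
Hypothesis AE : forall x, U x -> A x = adjoint B (P x).
Hypothesis adjBE : forall x, U x -> adjoint B x = adjoint P (A x).

(** The fundamental equations make [A] commute with the adjoint of [P] on the
    unitary part, so that [A] preserves the orbit conditions that define it. *)
Lemma unitary_part_invariant x : U x -> U (A x).
Proof.
have [UP UQ] := @unitary_part_reduces _ _ P.
have QPA y : U y -> adjoint P (P (A y)) = A y.
  by move=> Uy; rewrite -AP -adjBE ?AE//; exact: UP.
have QA y : U y -> adjoint P (A y) = A (adjoint P y).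
  move=> Uy; rewrite -{1}(unitary_partQK Uy) AP QPA//; exact: UQ.
move=> Ux; apply: (@isometry_orbit_in_unitary_part _ _ P (fun y => exists2 x, U x & y = A x)).
  move=> {x Ux} _ [x Ux ->]; split.
  - by exists (P x); [exact: UP|rewrite AP].
  - by exists (adjoint P x); [exact: UQ|rewrite QA].
  - exact: QPA.
  - by rewrite QA// -AP (unitary_partQK Ux).
by exists x.
Qed.

End ReducingSubspace.

Section UnitaryNormal.
Context (R : realType) (K : hilbertType R).
Variables (A B P : boundedOp K).
Hypotheses (uP : unitary_op P) (AP : forall x, A (P x) = P (A x))
  (AB : forall x, A (B x) = B (A x)).
Hypothesis adjAE : forall x, adjoint A x = adjoint P (B x).

Lemma unitary_normal : normal_op P.
Proof. by move=> x; rewrite uP.1 uP.2. Qed.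

(** Both products equal [P* A B], since [P* A = A P*] for unitary [P]. *)
Lemma normal_of_fundamental_equation : normal_op A.
Proof.
move=> x; rewrite !adjAE -AB.
by rewrite -{2}[B x](uP.2) AP uP.1.
Qed.

End UnitaryNormal.

(** * Resolvents of unitary operators *)

Section Resolvent.
Context (R : realType) (K : hilbertType R) (P : boundedOp K).
Hypothesis uP : unitary_op P.

Lemma unitary_rnorm x : rnorm (adjoint P x) = rnorm x.
Proof.
apply/eqP; rewrite -(@eqrXn2 _ 2) ?rnorm_ge0//; apply/eqP/complexI.
by rewrite !rmorphXn/= -!normE !inner_norm adjointE' uP.2.
Qed.

(** The equation [P x - l x = y] says that [x] is a fixed point of
    [x |-> P^* (y + l x)], a contraction when [|l| < 1]. *)
Lemma unitary_resolvent (l : R[i]) : `|l| < 1 ->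
  exists Q : {linear K -> K}, (forall x, P (Q x) - l *: Q x = x) /\
    forall x, Q (P x - l *: x) = x.
Proof.
move=> l1; pose r := re `|l|.
have rE : `|l| = r%:C by rewrite RRe_real// ger0_real.
have r0 : 0 <= r by rewrite -ler0c -rE.
have r1 : r < 1 by rewrite -ltcR -rE.
have inj x y : P x - l *: x = P y - l *: y -> x = y.
  move=> /eqP; rewrite -subr_eq0 opprD addrACA -opprD -linearB/=.
  rewrite -scalerBr subr_eq0 => /eqP Pxy; apply/eqP; rewrite -subr_eq0 -normr_eq0 normE.
  have : rnorm (x - y) = r * rnorm (x - y).
    by rewrite -rnormZc -Pxy -[RHS](unitary_rnorm (P _)) uP.1.
  move/eqP; rewrite -subr_eq0 -{1}[rnorm _]mul1r -mulrBl mulf_eq0.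
  by rewrite subr_eq0 gt_eqF//= => /eqP ->.
have surj y : exists x, P x - l *: x = y.
  pose f x := adjoint P (y + l *: x).
  pose u n := iter n f 0.
  have fB a b : rnorm (f a - f b) = r * rnorm (a - b).
    rewrite /f -adjointB unitary_rnorm opprD addrACA subrr add0r -scalerBr.
    exact: rnormZc.
  pose c := rnorm (u 1%N).
  pose d := c / (1 - r).
  have d0 : 0 <= d by rewrite divr_ge0 ?rnorm_ge0// subr_ge0 ltW.
  have uk k : rnorm (u k) <= d.
    elim: k => [|k IH]; first by rewrite /u /= /rnorm normr0.
    have -> : u k.+1 = (f (u k) - f 0) + u 1%N by rewrite /u /= subrK.
    apply: le_trans (rnormD _ _) _; rewrite fB subr0.
    apply: le_trans (lerD (ler_wpM2l r0 IH) (lexx _)) _.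
    have -> : rnorm (u 1%N) = (1 - r) * d by rewrite mulrC divfK// subr_eq0 gt_eqF.
    by rewrite -mulrDl addrC subrK mul1r.
  have e0 (k : R) : (fun n => k * r ^+ n) @ \oo --> 0.
    rewrite -[X in _ --> X](mulr0 k); apply: cvgMr.
    by apply: cvg_expr; rewrite ger0_norm.
  have [x ux ex] : exists2 x, u @ \oo --> x &
      forall n, rnorm (u n - x) <= (2 * d) * r ^+ n.
    apply: complete_cvg (e0 _) => n m nm.
    rewrite -(subnKC nm); move: (m - n)%N => k; elim: n {nm} => [|n IH].
      rewrite expr0 mulr1 add0n mulr2n mulrDl mul1r.
      by apply: le_trans (rnormB _ _) _; rewrite lerD.
    by rewrite exprS mulrCA addSn /u /= fB ler_wpM2l.
  exists x; suff fx : f x = x.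
    by rewrite -{1}fx /f uP.2 addrK.
  apply/eqP; rewrite -subr_eq0 -normr_eq0 normE.
  apply/eqP/(congr1 (real_complex R))/(le_cvg0_eq0 (rnorm_ge0 _)); last exact: (e0 (4 * d)).
  move=> n; have -> : f x - x = (f x - f (u n)) + (u n.+1 - x) by rewrite addrA subrK.
  apply: le_trans (rnormD _ _) _; rewrite fB -rnormN opprB.
  have -> : 4 * d * r ^+ n = 2 * d * r ^+ n + 2 * d * r ^+ n by ring.
  apply: lerD.
    by apply: le_trans (ex n); rewrite ler_piMl ?rnorm_ge0// ltW.
  apply: le_trans (ex n.+1) _; rewrite exprS mulrCA.
  by apply: ler_piMl; [apply: mulr_ge0; [exact: mulr_ge0|exact: exprn_ge0]|exact: ltW].
have /choice[Q QK] := surj.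
have QL : linear Q.
  move=> a x y; apply: inj; rewrite QK linearP scalerDr opprD addrACA.
  by rewrite scalerA mulrC -scalerA -scalerBr !QK.
pose Q' : {linear K -> K} :=
  HB.pack Q (GRing.isLinear.Build R[i] K K *:%R Q QL).
by exists Q'; split=> [|x]; [exact: QK|apply: inj; rewrite QK].
Qed.

End Resolvent.

(** * Spectral sets and reducing subspaces *)

HB.instance Definition _ (R : realType) (H : hilbertType R) (M : closedSubspace H) :=
  GRing.isLinear.Build R[i] H H _ (proj M) (proj_linear M).

Section SpectralRestriction.
Context (R : realType) (H : hilbertType R) (M : closedSubspace H) (n : nat).
Variables (T : 'I_n -> boundedOp H) (T' : 'I_n -> boundedOp (subHilbert M)).
Hypotheses (TM : forall i, reduces (T i) M)
  (valT' : forall i x, val (T' i x) = T i (val x)).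
Implicit Types (p q : mpoly n R[i]).

Lemma proj_sub_scale i (l : R[i]) x :
  proj M (T i x - l *: x) = T i (proj M x) - l *: proj M x.
Proof.
rewrite linearB linearZ/=; congr (_ - _); have [Mx xp] := projP M x.
apply: proj_uniq; first exact: (TM i).1.
by rewrite -linearB; exact: (reduces_orthocomplement (TM i)).1.
Qed.

(** Exactness passes to the direct summand: a preimage found in the whole space
    is projected, since the projection commutes with the differential. *)
Lemma taylor_spectrum_restr : taylor_spectrum T' `<=` taylor_spectrum T.
Proof.
move=> l /= nex ex; apply: nex => f kf.
have valK g A : val (koszul (fun i x => T' i x - l ord0 i *: x) g A) =
    koszul (fun i x => T i x - l ord0 i *: x) (fun B => val (g B)) A.
  rewrite raddf_sum; apply: eq_bigr => i _.
  rewrite linearZ/=; congr (_ *: _).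
  by have /= -> := valT' i (g (A :\ i)%SET); rewrite scalerN.
have [g kg] : exists g, koszul (fun i x => T i x - l ord0 i *: x) g =1 (fun B => val (f B)).
  by apply: ex => A; rewrite -valK kf raddf0.
have pM x : M (proj M x) by case: (projP M x).
exists (fun A => exist _ (proj M (g A)) (mem_set (pM _)) : subHilbert M) => A.
apply: val_inj; rewrite valK /= -(proj_id (subHilbertP (f A))) -kg linear_sum.
apply: eq_bigr => i _; rewrite [RHS]linearZ/=; congr (_ *: _).
exact/esym/proj_sub_scale.
Qed.

Lemma val_poly_op p x : val (poly_op T' p x) = poly_op T p (val x).
Proof.
rewrite /poly_op raddf_sum; apply: eq_bigr => m _ /=; congr (_ *: _).
move: x; apply: (big_ind2 (fun (f' : subHilbert M -> subHilbert M) (f : H -> H) =>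
  forall x, val (f' x) = f (val x))) => //.
  by move=> f1 f2 g1 g2 e1 e2 x; rewrite /= e1 e2.
by move=> i _ x; elim: (fun_of_multinom m i) => [//|k IH]; rewrite 2!iterS valT' IH.
Qed.

(** For a subspace [N] that reduces the tuple, the component of [Q x] orthogonal
    to [N] is sent by [q(T)] both into [N] and into its complement. *)
Lemma inverse_reduces q (Q : boundedOp H) :
  cancel Q (poly_op T q) -> cancel (poly_op T q) Q -> reduces Q M.
Proof.
move=> QK KQ.
have inv N : (forall i, reduces (T i) N) -> forall x, N x -> N (Q x).
  move=> TN x Nx; have [Nm mp] := projP N (Q x); set m := proj N _ in Nm mp.
  have pN := @poly_op_invariant _ _ _ T N q (fun i => (TN i).1).
  have pp := @poly_op_invariant _ _ _ T (orthocomplement N) q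
    (fun i => (reduces_orthocomplement (TN i)).1).
  have : poly_op T q (Q x - m) = 0.
    apply: (@orthocomplement_disjoint _ _ N); last exact: pp.
    have -> : Q x - m = (-1) *: m + Q x by rewrite scaleN1r addrC.
    by rewrite poly_op_linear QK; apply/subspaceD => //; exact/subspaceZ/pN.
  move/(congr1 Q); rewrite KQ linear0 => /eqP; rewrite subr_eq0 => /eqP ->.
  exact: Nm.
apply: reduces_of_invariant; first exact: inv.
by apply: inv => i; exact: reduces_orthocomplement.
Qed.

(** A reducing subspace inherits spectral sets: the Koszul complex of the
    restriction is a direct summand, and the resolvents restrict. *)
Theorem spectral_set_restr X : spectral_set X T -> spectral_set X T'.
Proof.
move=> [cX cT sX rX]; split=> //.
- by move=> i j x; apply: val_inj; rewrite /= !valT' cT.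
- exact: subset_trans taylor_spectrum_restr sX.
move=> p q q0; have [Q [QK KQ pQ]] := rX p q q0.
have QM := inverse_reduces QK KQ; exists (restr QM); split.
- by move=> x; apply: val_inj; rewrite val_poly_op /= QK.
- by move=> x; apply: val_inj; rewrite /= val_poly_op KQ.
apply: le_trans pQ; apply: opnorm_le => x x1.
have -> : rnorm ((poly_op T' p \o restr QM) x) = rnorm ((poly_op T p \o Q) (val x)).
  rewrite /= /rnorm; congr (re _).
  by have -> : forall y : subHilbert M, `|y| = `|val y| by []; rewrite val_poly_op.
have [c c0 pc] := poly_op_bounded T p; have [d d0 Qd] := boundedOp_real Q.
apply: (@opnorm_ub _ _ _ (c * d)) => //; last exact: mulr_ge0.
by move=> y; apply: le_trans (pc _) _; rewrite -mulrA ler_wpM2l.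
Qed.

End SpectralRestriction.

(** * Exactness of Koszul complexes and the joint spectrum *)

Section KoszulHomotopy.
Context (R : realType) (K : hilbertType R) (n : nat).
Variables (T : 'I_n.+1 -> {linear K -> K}) (Q : {linear K -> K}).
Hypotheses (QT : forall i x, Q (T i x) = T i (Q x)) (TQ : forall x, T ord_max (Q x) = x).

(** Up to signs, applying [Q] and contracting with the last basis vector of the
    exterior algebra is a homotopy from the identity to zero. *)
Lemma koszul_exact_of_invertible : koszul_exact (fun i x => T i x).
Proof.
move=> f kf; pose k : 'I_n.+1 := ord_max.
exists (fun A : {set 'I_n.+1} => if k \in A then 0 else (-1) ^+ #|A| *: Q (f (k |: A)%SET)) => A.
have ltk (i : 'I_n.+1) : i != k -> (i < k)%N.
  by move=> ik; rewrite ltn_neqAle ik -ltnS ltn_ord.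
rewrite /koszul; have [kA|kA] := boolP (k \in A).
  rewrite (bigD1 k)//= setD11 [X in _ + X]big1 => [|i /andP[iA ik]]; last first.
    by rewrite in_setD1 eq_sym ik kA linear0 scaler0.
  (* Only [i = k] contributes: the chosen preimage vanishes on sets that
     contain [k]. *)
  have -> : [set j in A | (j < k)%N]%SET = (A :\ k)%SET.
    apply/setP => j; rewrite !inE andbC; case: eqVneq => [->|/ltk ->//].
    by rewrite ltnn.
  rewrite addr0 finset.setD1K// linearZ/= scalerA -exprD addnn -signr_odd odd_double.
  by rewrite expr0 scale1r TQ.
(* The cycle condition at [k |: A], solved for the term [i = k]. *)
have kfA : \sum_(i in A) (-1) ^+ #|[set j in A | (j < i)%N]%SET| *:
    T i (f (k |: (A :\ i))%SET) = - ((-1) ^+ #|A| *: T k (f A)).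
  have := kf (k |: A)%SET; rewrite /koszul (big_setU1 _ kA)/= finset.setU1K//.
  have -> : [set j in (k |: A)%SET | (j < k)%N]%SET = A.
    apply/setP => j; rewrite !inE; case: eqVneq => [->|/ltk ->] /=.
      by rewrite ltnn (negPf kA).
    by rewrite andbT.
  move/eqP; rewrite addr_eq0 => /eqP ->; rewrite opprK; apply: eq_bigr => i iA.
  have ik : i != k by apply: contraNneq kA => <-.
  congr (_ ^+ _ *: T i (f _)).
    apply: eq_card => j; rewrite !inE; case: eqVneq => [->|//] /=.
    by rewrite (negPf kA) ltnNge ltnW ?ltk.
  by apply/setP => j; rewrite !inE; case: (eqVneq j k) => [->|]; rewrite ?(eq_sym k) ?ik.
transitivity (\sum_(i in A) (- (-1) ^+ #|A|) *: Q ((-1) ^+ #|[set j in A | (j < i)%N]%SET| *: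
    T i (f (k |: (A :\ i))%SET))).
  apply: eq_bigr => i iA; rewrite in_setD1 (negPf kA) andbF !linearZ/= QT.
  by rewrite !scalerA (cardsD1 i A) iA add1n exprS mulN1r opprK mulrC.
rewrite -scaler_sumr -linear_sum kfA linearN linearZ/= scalerN scaleNr opprK.
rewrite scalerA -exprD addnn -signr_odd odd_double expr0 scale1r QT.
exact: TQ.
Qed.

End KoszulHomotopy.

Section Shift.
Context (R : realType) (K : hilbertType R) (T : boundedOp K) (l : R[i]).

(** A copy of the operator [T - l] that carries its linear structure. *)
Definition shift (x : K) : K := T x - l *: x.

Fact shift_linear : linear shift.
Proof.
by move=> a x y; rewrite /shift linearP scalerDr opprD addrACA scalerA mulrC -scalerA -scalerBr.
Qed.

HB.instance Definition _ := GRing.isLinear.Build R[i] K K *:%R shift shift_linear.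

End Shift.

Section UnitarySpectrum.
Context (R : realType) (K : hilbertType R) (n : nat) (T : 'I_n.+1 -> boundedOp K).

(** With the last coordinate in the open disc, the resolvent of the last
    operator would make the Koszul complex exact. *)
Lemma taylor_spectrum_unitary l : commuting T -> unitary_op (T ord_max) ->
  taylor_spectrum T l -> ~~ (`|l ord0 ord_max| < 1).
Proof.
move=> cT uT lT; apply/negP => /(unitary_resolvent uT)[Q [TQ QT]]; apply: lT.
apply: (@koszul_exact_of_invertible _ _ _ (fun i => @shift _ K (T i) (l ord0 i)) Q _ TQ).
move=> i x; have e : @shift _ K (T i) (l ord0 i) x =
    @shift _ K (T ord_max) (l ord0 ord_max) (@shift _ K (T i) (l ord0 i) (Q x)).
  rewrite -{1}(TQ x) /shift !linearB !linearZ/= (cT i) !scalerA.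
  by rewrite (mulrC (l ord0 i)) -!addrA; congr (_ + _); rewrite addrCA.
exact: etrans (congr1 Q e) (QT _).
Qed.

End UnitarySpectrum.

(** * The canonical decomposition *)

Section Gamma3Decomposition.
Context (R : realType) (H : hilbertType R) (S1 S2 P : boundedOp H).
Hypothesis GT : Gamma3_contraction S1 S2 P.
Local Notation U := (unitary_part P).
Let i0 : 'I_3 := ord0.
Let i1 : 'I_3 := lift ord0 ord0.
Let i2 : 'I_3 := ord_max.

Lemma ord3_ind (Q : 'I_3 -> Prop) : Q i0 -> Q i1 -> Q i2 -> forall i, Q i.
Proof.
move=> Q0 Q1 Q2 [[|[|[|//]]] h].
- by rewrite (_ : Ordinal h = i0)//; exact: val_inj.
- by rewrite (_ : Ordinal h = i1)//; exact: val_inj.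
- by rewrite (_ : Ordinal h = i2)//; exact: val_inj.
Qed.

Lemma Gamma3_contraction_comm :
  [/\ forall x, S1 (P x) = P (S1 x), forall x, S2 (P x) = P (S2 x) &
      forall x, S1 (S2 x) = S2 (S1 x)].
Proof.
by case: GT => _ cT _ _; split=> x; [exact: (cT i0 i2)|exact: (cT i1 i2)|exact: (cT i0 i1)].
Qed.

Lemma Gamma3_contraction_contractive x : rnorm (P x) <= rnorm x.
Proof.
have := spectral_set_le GT (Gamma3_neq0 R) (p := mpolyX R[i] (mnm1 i2)) (q := 1) _ _ x.
rewrite poly_op_var poly_op1; apply.
  by move=> z _; rewrite /peval meval1 oner_eq0.
move=> _ [z1 [z2 [z3 [h1 h2 h3 ->]]]].
rewrite /peval meval1 mevalXU mxE normr1 /= !normrM.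
by rewrite mulr_ile1 ?mulr_ge0 ?mulr_ile1.
Qed.

Lemma Gamma3_fundamental_equations x : U x ->
  [/\ S1 x = adjoint S2 (P x), adjoint S1 x = adjoint P (S2 x),
      S2 x = adjoint S1 (P x) & adjoint S2 x = adjoint P (S1 x)].
Proof.
move=> /unitary_partPK Px; have pen := Gamma3_contraction_pencils GT.
have [e1 e2] := fundamental_equations (fundamental_form pen) Px.
have pen' w (w1 : `|w| = 1) y := conj (pen w w1 y).2 (pen w w1 y).1.
by have [e3 e4] := fundamental_equations (fundamental_form pen') Px; split.
Qed.

(** On the unitary part the adjoints are [S1* = P* S2] and [S2* = P* S1], so
    their invariance follows from that of [S1] and [S2]. *)
Lemma unitary_part_reduces_symm : reduces S1 U /\ reduces S2 U.
Proof.
have [c1 c2 _] := Gamma3_contraction_comm; have [PU QU] := @unitary_part_reduces _ _ P.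
have E := Gamma3_fundamental_equations.
have U1 x : U x -> U (S1 x).
  by apply: (@unitary_part_invariant _ _ S1 S2) => // y /E[].
have U2 x : U x -> U (S2 x).
  by apply: (@unitary_part_invariant _ _ S2 S1) => // y /E[].
split; split=> // x Ux; have [_ e1 _ e2] := E _ Ux.
  by rewrite e1; exact/QU/U2.
by rewrite e2; exact/QU/U1.
Qed.

Variable M : closedSubspace H.
Hypotheses (M1 : reduces S1 M) (M2 : reduces S2 M) (MP : reduces P M).

Lemma Gamma3_contraction_restr : Gamma3_contraction (restr M1) (restr M2) (restr MP).
Proof.
apply: spectral_set_restr GT; first exact: ord3_ind.
exact: ord3_ind.
Qed.

(** A point of the tridisc is on the distinguished boundary as soon as its last
    coordinate, the product of the three roots, has modulus 1. *)
Lemma Gamma3_unitary_restr : (forall x, M x -> U x) ->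
  Gamma3_unitary (restr M1) (restr M2) (restr MP).
Proof.
move=> MU; have GM := Gamma3_contraction_restr; have [_ cM sM _] := GM.
have [c1 c2 c12] := Gamma3_contraction_comm.
have a1 := val_adjoint M1 (T' := restr M1) (fun=> erefl).
have a2 := val_adjoint M2 (T' := restr M2) (fun=> erefl).
have aP := val_adjoint MP (T' := restr MP) (fun=> erefl).
have uM : unitary_op (restr MP).
  split=> x; apply: val_inj; have Ux := MU _ (subHilbertP x).
    by rewrite aP /= unitary_partPK.
  by rewrite /= aP unitary_partQK.
have E x := Gamma3_fundamental_equations (MU _ (subHilbertP x)).
split=> //.
- apply: (@normal_of_fundamental_equation _ _ _ (restr M2) (restr MP)) => // x.
  + by apply: val_inj; rewrite /= c1.
  + by apply: val_inj; rewrite /= c12.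
  + by apply: val_inj; rewrite a1 aP; have [_ ->] := E x.
- apply: (@normal_of_fundamental_equation _ _ _ (restr M1) (restr MP)) => // x.
  + by apply: val_inj; rewrite /= c2.
  + by apply: val_inj; rewrite /= c12.
  + by apply: val_inj; rewrite a2 aP; have [_ _ _ ->] := E x.
- exact: unitary_normal.
move=> l sl; have [z1 [z2 [z3 [h1 h2 h3 lE]]]] := sM _ sl.
have := taylor_spectrum_unitary cM uM sl; rewrite lE mxE /= !normrM => n1.
have n123 : `|z1| * `|z2| * `|z3| = 1.
  apply/eqP; rewrite eq_le mulr_ile1 ?mulr_ge0 ?mulr_ile1//=.
  by rewrite real_leNgt ?ger0_real ?mulr_ge0.
have eq1 (a b : R[i]) : 0 <= a -> 0 <= b -> a <= 1 -> b <= 1 -> a * b = 1 -> b = 1.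
  move=> a0 b0 a1' b1 ab; apply/eqP; rewrite eq_le b1 -{1}ab.
  by rewrite ler_piMl.
exists z1, z2, z3; split=> //.
- apply: (eq1 (`|z2| * `|z3|)); rewrite ?mulr_ge0 ?mulr_ile1//.
  by rewrite mulrC mulrA.
- apply: (eq1 (`|z1| * `|z3|)); rewrite ?mulr_ge0 ?mulr_ile1//.
  by rewrite mulrAC.
- by apply: (eq1 (`|z1| * `|z2|)); rewrite ?mulr_ge0 ?mulr_ile1.
Qed.

(** A subspace of [M] on which [P] is unitary consists of vectors of the unitary
    part of [P] in the whole space. *)
Lemma cnu_restr : (forall x, M x -> U x -> x = 0) -> cnu_contraction (restr MP).
Proof.
move=> MU; split.
  apply: opnorm_le => x x1; rewrite -lecR rmorph1 -normE.
  apply: le_trans x1; rewrite !normE lecR.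
  exact: Gamma3_contraction_contractive.
move=> N /unitary_onP[[PN QN] NP] x Nx; apply: val_inj.
have aP := val_adjoint MP (T' := restr MP) (fun=> erefl).
apply: MU; first exact: subHilbertP.
apply: (@isometry_orbit_in_unitary_part _ _ P (fun y => exists2 x, N x & y = val x));
  last by exists x.
move=> {x Nx} _ [x Nx ->]; have [e1 e2] := NP _ Nx; split.
- by exists (restr MP x); [exact: PN|].
- by exists (adjoint (restr MP) x); [exact: QN|rewrite aP].
- by have := congr1 val e1; rewrite aP.
- by have := congr1 val e2; rewrite /= aP.
Qed.

End Gamma3Decomposition.

Theorem theorem1p4 (R : realType) (H : hilbertType R) (S1 S2 P : boundedOp H) :
  Gamma3_contraction S1 S2 P ->
  (exists H1 : closedSubspace H, maximal_unitary_subspace P H1) /\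
  forall H1 : closedSubspace H, maximal_unitary_subspace P H1 ->
    let H2 := orthocomplement H1 in
    exists (S1H1 : reduces S1 H1) (S2H1 : reduces S2 H1) (PH1 : reduces P H1)
      (S1H2 : reduces S1 H2) (S2H2 : reduces S2 H2) (PH2 : reduces P H2),
      Gamma3_unitary (restr S1H1) (restr S2H1) (restr PH1) /\
      cnu_Gamma3_contraction (restr S1H2) (restr S2H2) (restr PH2).
Proof.
move=> GT; split; first by exists (unitary_part P); exact: unitary_part_maximal.
move=> H1 [uH1 maxH1] H2.
have [uU maxU] := unitary_part_maximal P.
have H1U x : H1 x <-> unitary_part P x by split; [exact: maxU uH1 _|exact: maxH1 uU _].
have red T : reduces T (unitary_part P) -> reduces T H1.
  by move=> [TU aU]; split=> x /H1U Ux; apply/H1U; [exact: TU|exact: aU].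
have [/red R1 /red R2] := unitary_part_reduces_symm GT.
have RP := red _ (@unitary_part_reduces _ _ P).
exists R1, R2, RP, (reduces_orthocomplement R1), (reduces_orthocomplement R2),
  (reduces_orthocomplement RP).
split; first by apply: Gamma3_unitary_restr => // x /H1U.
split; first exact: Gamma3_contraction_restr.
apply: (cnu_restr GT) => x H2x /H1U H1x.
exact: orthocomplement_disjoint H1x H2x.
Qed.
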